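(* Let $K$ be a number field with ring of integers $\mathcal{O}_K$, let $d\ge 2$ be an integer, let $a\in\mathcal{O}_K$, and let $f(x)=ux^d+b\in\mathcal{O}_K[x]$ where $u$ is a unit of $\mathcal{O}_K$. Then $(f(x),a)$ is dynamically monogenic (and in particular, dynamically irreducible) if and only if both of the following hold: 1. For each $n\in\mathbb{N}$ and each prime $\mathfrak{p}$ of $\mathcal{O}_K$ not dividing $d$, one has $v_{\mathfrak{p}}(f^n(0)-a)\le 1$. 2. For each prime $\mathfrak{p}$ of $\mathcal{O}_K$ of residue characteristic $p$ dividing $d$, the ratio $\frac{a-b}{u}$ is not congruent to any $p$-th power modulo $\mathfrak{p}^2$.
   Context: $f^n$ denotes the $n$-fold composition of $f$; $\mathbb{N}=\{1,2,\dots\}$; $v_{\mathfrak{p}}$ is the normalized $\mathfrak{p}$-adic valuation with $v_{\mathfrak p}(0)=\infty$. A polynomial over $\mathcal{O}_K$ with unit leading coefficient is monogenic (over $K$) if it is irreducible over $K$ and, for a root $\alpha$, $\mathcal{O}_K[\alpha]=\mathcal{O}_{K(\alpha)}$. The pair $(f(x),a)$ is dynamically monogenic if $f^n(x)-a$ is monogenic for every $n\ge 1$, and dynamically irreducible if $f^n(x)-a$ is irreducible over $K$ for every $n\ge1$. *)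

(* Defs.v *)
From HB Require Import structures.
From mathcomp Require Import all_boot all_order all_algebra all_field.
From mathcomp Require Import ring_quotient.
From mathcomp Require Import boolp classical_sets constructive_ereal.

Set Implicit Arguments.
Unset Strict Implicit.
Unset Printing Implicit Defensive.

Import Order.TTheory GRing.Theory Num.Theory.
Local Open Scope ring_scope.
Local Open Scope classical_set_scope.

Definition algint (F : fieldType) : {pred F} :=
  fun x => `[< integralOver (intr : int -> F) x >].

Lemma algintP (F : fieldType) (x : F) :
  reflect (integralOver (intr : int -> F) x) (x \in @algint F).
Proof. exact: asboolP. Qed.

Lemma algint_subring (F : fieldType) : subring_closed (@algint F).
Proof.
split; first by apply/algintP; exact: integral1.
- by move=> x y /algintP hx /algintP hy; apply/algintP; exact: integral_sub.
- by move=> x y /algintP hx /algintP hy; apply/algintP; exact: integral_mul.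
Qed.

HB.instance Definition _ (F : fieldType) :=
  GRing.isSubringClosed.Build F (@algint F) (@algint_subring F).

Record ring_of_integers (F : fieldType) :=
  RingOfIntegers { oval : F; ovalP : oval \in @algint F }.

HB.instance Definition _ (F : fieldType) := [isSub of ring_of_integers F for @oval F].
HB.instance Definition _ (F : fieldType) := [Choice of ring_of_integers F by <:].
HB.instance Definition _ (F : fieldType) :=
  [SubChoice_isSubComNzRing of ring_of_integers F by <:].

Section UnitRing.
Variable F : fieldType.

Definition ounit : {pred ring_of_integers F} := fun x => `[< exists y, y * x = 1 >].

Definition oinv (x : ring_of_integers F) : ring_of_integers F :=
  if pselect (exists y, y * x = 1) is left h then sval (cid h) else x.

Lemma omulVx : {in ounit, left_inverse 1 oinv *%R}.
Proof.
move=> x /asboolP ux; rewrite /oinv.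
by case: pselect => // h; case: (cid h).
Qed.

Lemma ounitPl (x y : ring_of_integers F) : y * x = 1 -> ounit x.
Proof. by move=> yx; apply/asboolP; exists y. Qed.

Lemma oinv_out : {in [predC ounit], oinv =1 id}.
Proof.
move=> x; rewrite inE => /asboolP nux; rewrite /oinv.
by case: pselect.
Qed.

HB.instance Definition _ :=
  GRing.ComNzRing_hasMulInverse.Build (ring_of_integers F) omulVx ounitPl oinv_out.

Lemma omulf_eq0 (x y : ring_of_integers F) : x * y = 0 -> (x == 0) || (y == 0).
Proof. by move/(congr1 val); rewrite rmorphM /= => /eqP; rewrite mulf_eq0. Qed.

HB.instance Definition _ := GRing.ComUnitRing_isIntegral.Build (ring_of_integers F) omulf_eq0.

End UnitRing.

Section IdealPowers.
Variable R : comNzRingType.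

Definition ideal_mul (I J : set R) : set R :=
  [set x | exists2 s : seq (R * R),
     (forall z, z \in s -> I z.1 /\ J z.2) & x = \sum_(z <- s) z.1 * z.2].

Definition ideal_exp (I : set R) (n : nat) : set R :=
  iter n (ideal_mul I) setT.

(* The largest n with x in P^n, that is, the least n with x not in P^(n+1)
   (the powers of P are decreasing), and +oo if x lies in every power of P. *)
Definition adic_val (P : prime_idealr R) (x : R) : \bar int :=
  if pselect (exists n, x \notin ideal_exp [set` P] n.+1) is left h
  then ((ex_minn h)%:Z)%:E else +oo%E.

Definition nonzero_ideal (P : {pred R}) : Prop := exists2 x, x \in P & x != 0.

Definition residue_char (P : prime_idealr R) (p : nat) : Prop :=
  p \in [pchar {ideal_quot P}].

Definition poly_iter (f : {poly R}) (n : nat) : {poly R} :=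
  iter n (fun g => f \Po g) 'X.

End IdealPowers.

Section Monogenic.
Variable K : fieldExtType rat.

Definition irreducible_over (g : {poly ring_of_integers K}) : Prop :=
  irreducible_poly (map_poly val g : {poly K}).

Definition oalg (L : fieldExtType K) (c : ring_of_integers K) : L := (val c)%:A.

(* K(alpha) is the subfield <<1; alpha>> of an arbitrary finite extension L of
   K; when g is irreducible, some L contains a root (see irredp_FAdjoin), so the
   last clause is not vacuous. *)
Definition monogenic (g : {poly ring_of_integers K}) : Prop :=
  [/\ lead_coef g \is a GRing.unit,
      irreducible_over g
    & forall (L : fieldExtType K) (alpha : L),
        root (map_poly (@oalg L) g) alpha ->
        [set (map_poly (@oalg L) q).[alpha] | q in [set: {poly ring_of_integers K}]]
        = [set x : L | x \in <<1; alpha>>%VS /\ x \in @algint L]].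

Definition dynamically_monogenic (f : {poly ring_of_integers K}) (a : ring_of_integers K) : Prop :=
  forall n : nat, (0 < n)%N -> monogenic (poly_iter f n - a%:P).

Definition dynamically_irreducible (f : {poly ring_of_integers K}) (a : ring_of_integers K) : Prop :=
  forall n : nat, (0 < n)%N -> irreducible_over (poly_iter f n - a%:P).

End Monogenic.

(* Main.v *)
Require Import Defs.
From HB Require Import structures.
From mathcomp Require Import all_boot all_order all_algebra all_field.
From mathcomp Require Import cyclic ring_quotient ring.
From mathcomp Require Import boolp classical_sets constructive_ereal.

Set Implicit Arguments.
Unset Strict Implicit.
Unset Printing Implicit Defensive.

Import Order.TTheory GRing.Theory Num.Theory.
Local Open Scope ring_scope.
Local Open Scope classical_set_scope.

(** Write phi(x) = u x^d + b, let alpha_n be a root of phi^n(x) = a, and put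
    alpha_(j-1) = phi(alpha_j), so that alpha_0 = a.  The proof climbs the tower
    R_0 = O_K, R_j = R_(j-1)[alpha_j] = O_K[alpha_j]: each storey adjoins a d-th
    root of t = (alpha_(j-1) - b) / u.

    Sufficiency.  Call a nonzero prime P of an order R locally principal if P R_P
    is generated by one element.  An order all of whose primes are locally
    principal is integrally closed ([integrally_closed_of_locally_principal]), so
    it suffices to carry three properties from R = R_(j-1) to S = R_j
    ([tower_ready], [tower_ready_extension]): local principality, the bound on
    the critical orbit relative to alpha_j, and the fact that
    (alpha_j - b) / u is not a p-th power modulo the square of a prime above
    p | d.  Let Q be a prime of S and P its contraction.
    - If t lies in P, both conditions say that t is not in P^2, hence t generates P
      locally, and x^d - t is Eisenstein: alpha generates Q locally.
    - If p | d lies in P and t does not, write d = p^k m with m prime to p and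
      choose c with c^(p^k) = t mod P.  Then t - c^(p^k) is not in P^2, and the
      shift of x^(p^k) - t by c is Eisenstein with root g = alpha^m - c; above it,
      x^m - (c + g) is unramified.  So g generates Q locally.
    - Otherwise x^d - t is separable modulo P and a generator of P works for Q.
    The uniform argument behind all three is [locgen_extension]: modulo the ideal
    of local multiples of the proposed generator, a power of Frobenius fixes
    alpha, hence all of S.
    In the first two cases Q is ramified over P, that is, P is contained in Q^2.
    Consequently p lies in Q^2, p-th powers modulo Q^2 form a ring containing R,
    and (alpha - b) / u cannot be one of them without forcing g into Q^2.  The
    orbit condition is inherited because phi(y) - phi(alpha) is a multiple of
    y - alpha.
    For irreducibility, the Eisenstein shift makes the first p^k powers of
    alpha^m - c linearly independent over R ([powers_independent]), so p^k divides
    the degree of each storey for every prime power p^k exactly dividing d; the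
    storey then has degree d and K(alpha_n) has degree d^n ([dim_Fadjoin_iter]).

    Necessity.  Choose lambda in P^(-1) outside O_K ([inverse_prime]).  If one of
    the conditions fails at P, then, up to a unit,
    phi^n(x) - a = G(x) D(x) + e with e in P^2 and
    D congruent to a multiple of G modulo P, where G = x or G = x^m - c.  Then
    y = lambda D(alpha) satisfies a monic quadratic equation with integral
    coefficients, yet y is not in O_K[alpha] because D has unit leading coefficient
    and smaller degree ([not_monogenic]).

    Finiteness enters only through the fact that R / pR is finite for every
    subring R of a number field ([residues_finite]).  It provides maximal ideals,
    annihilators, and the exponents of residue fields. *)

(** Characteristic zero and bounded rank over the integers, stated without reference to
    a scalar structure so that an extension of [K] can be used as a bare field. *)
Definition number_field (Om : fieldType) : Prop :=
  (forall n : nat, (n%:R == 0 :> Om) = (n == 0%N)) /\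
  exists n, forall v : nat -> Om,
    exists2 c : nat -> int, (exists2 i, (i < n)%N & c i != 0) &
      \sum_(i < n) (c i)%:~R * v i = 0.

(** The cofactor is read off from the constant coefficient of an integral equation of
    [x], after division by a power of the variable. *)
Lemma algint_int_multiple (F : fieldType) (R : subringClosed F) (x : F) :
  x \in R -> x \in @algint F -> x != 0 ->
  exists2 N : int, N != 0 & exists2 r, r \in R & x * r = N%:~R.
Proof.
move=> xR /algintP[q qmon qx] x0.
have {qmon} q0 : q != 0 by apply: monic_neq0.
have [m] := ubnP (size q); elim: m q q0 qx => // m IH q q0 qx lqm.
have [q1 [c def_q]] : exists q1, exists c, q = q1 * 'X + c%:P.
  by elim/poly_ind: (q) => [|p c _]; [exists 0, 0; rewrite mul0r addr0 | exists p, c].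
have hx : (map_poly (intr : int -> F) q1).[x] * x + c%:~R = 0.
  move: qx; rewrite rootE def_q rmorphD rmorphM /= map_polyX map_polyC /=.
  by rewrite !hornerE => /eqP.
have [c0|cN0] := eqVneq c 0.
  have q10 : q1 != 0.
    by apply: contraNneq q0 => q10; rewrite def_q c0 q10 mul0r addr0.
  apply: (IH q1) => //.
    rewrite rootE; move: hx; rewrite c0 addr0 => /eqP.
    by rewrite mulf_eq0 (negPf x0) orbF.
  by move: lqm; rewrite def_q c0 addr0 size_mulX.
exists (- c); first by rewrite oppr_eq0.
exists (map_poly (intr : int -> F) q1).[x].
  by rewrite rpred_horner //; apply/polyOverP => i; rewrite coef_map rpred_int.
by rewrite mulrC rmorphN; apply/eqP; rewrite -subr_eq0 opprK hx.
Qed.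

Section ResidueFinite.
Variables (Om : fieldType) (nf : number_field Om).
Variables (R : subringClosed Om) (p : nat) (p_pr : prime p).

Lemma prime_natr_neq0 : p%:R != 0 :> Om.
Proof. by rewrite nf.1 -lt0n prime_gt0. Qed.

Definition indep_modp k (x : nat -> Om) : Prop :=
  (forall i, x i \in R) /\
  forall (c : nat -> int) r, r \in R -> \sum_(i < k) (c i)%:~R * x i = p%:R * r ->
    forall i, (i < k)%N -> (p%:Z %| c i)%Z.

(** A primitive integral relation stays nontrivial modulo [p]; dividing a relation by
    [p] as long as possible makes it primitive. *)
Lemma not_indep_modp : exists n, forall x, ~ indep_modp n x.
Proof.
case: nf => _ [n hn]; exists n => x [xR xind].
have [c [i0 lti0 ci0] sum0] := hn x.
have [m] := ubnP (\sum_(i < n) `|c i|)%N.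
elim: m c ci0 sum0 => // m IH c ci0 sum0 lecm.
have dv i : (i < n)%N -> (p%:Z %| c i)%Z.
  by apply: (xind c 0); rewrite ?rpred0 // sum0 mulr0.
pose c' i := (c i %/ p%:Z)%Z.
have cE i : (i < n)%N -> c i = c' i * p%:Z by move/dv => d; rewrite divzK.
have c'i0 : c' i0 != 0.
  by apply: contraNneq ci0 => z; rewrite cE // z mul0r.
apply: (IH c') => //.
  apply: (mulfI prime_natr_neq0); rewrite mulr0 -[RHS]sum0 mulr_sumr.
  by apply: eq_bigr => i _; rewrite (cE i) // rmorphM /= mulrA [p%:R * _]mulrC.
apply: leq_trans (_ : \sum_(i < n) `|c i| <= m)%N; last by rewrite -ltnS.
rewrite (bigD1 (Ordinal lti0)) //= [X in (_ < X)%N](bigD1 (Ordinal lti0)) //=.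
rewrite -addSn leq_add //.
  rewrite cE // abszM /= -[X in (X < _)%N]muln1 ltn_pmul2l ?prime_gt1 //.
  by rewrite absz_gt0.
apply: leq_sum => i _; rewrite (cE i) // abszM /= -[X in (X <= _)%N]muln1.
by rewrite leq_mul // prime_gt0.
Qed.

(** [R / pR] is spanned over the field of [p] elements by a maximal family independent
    modulo [p], whose length is bounded by the rank. *)
Lemma residues_finite : exists2 s : seq Om, {subset s <= R} &
  forall x, x \in R -> exists2 y, y \in s & exists2 r, r \in R & x = y + p%:R * r.
Proof.
apply: contrapT => nofin; have [n hn] := not_indep_modp.
suff [x] : exists x, indep_modp n x by apply: hn.
elim: n {hn} => [|k [x [xR xind]]].
  by exists (fun=> 0); split=> // i; rewrite rpred0.
have [y yR nspan] : exists2 y, y \in R & ~ exists c : nat -> int,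
    exists2 r, r \in R & y = \sum_(i < k) (c i)%:~R * x i + p%:R * r.
  apply: contrapT => span; apply: nofin.
  pose g (f : {ffun 'I_k -> 'I_p}) := \sum_(i < k) (f i)%:R * x i.
  exists (codom g).
    by move=> _ /codomP[f ->]; rewrite rpred_sum // => i _; rewrite rpredM ?rpred_nat.
  move=> y yR.
  have [c [r rR def_y]] : exists c : nat -> int,
     exists2 r, r \in R & y = \sum_(i < k) (c i)%:~R * x i + p%:R * r.
    by apply: contrapT => ny; apply: span; exists y.
  have p_gt0 : 0 < p%:Z by rewrite ltz_nat prime_gt0.
  have cmod i : (`|(c i %% p%:Z)%Z|%N < p)%N.
    by rewrite -ltz_nat gez0_abs ?modz_ge0 ?lt0r_neq0 // ltz_pmod.
  exists (g [ffun i : 'I_k => Ordinal (cmod i)]); first exact: codom_f.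
  exists (\sum_(i < k) (c i %/ p%:Z)%Z%:~R * x i + r).
    by rewrite rpredD // rpred_sum // => i _; rewrite rpredM ?rpred_int.
  rewrite def_y mulrDr addrA; congr (_ + _); rewrite mulr_sumr -big_split /=.
  apply: eq_bigr => i _; rewrite ffunE /= mulrA -mulrDl; congr (_ * _).
  rewrite -[X in X + _]/((Posz _)%:~R) gez0_abs ?modz_ge0 ?lt0r_neq0 //.
  by rewrite {1}(divz_eq (c i) p%:Z) rmorphD rmorphM /= addrC mulrC.
pose x' i := if i == k then y else x i.
exists x'; split=> [i|c r rR].
  by rewrite /x'; case: ifP.
rewrite big_ord_recr /= {2}/x' eqxx.
rewrite (eq_bigr (fun i : 'I_k => (c i)%:~R * x i)); last first.
  by move=> i _; rewrite /x' ltn_eqF.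
move=> sumE.
have dvk : (p%:Z %| c k)%Z.
  apply/negPn/negP => ndv; apply: nspan.
  have cop : coprimez (c k) p%:Z.
    by rewrite coprimez_sym /coprimez /gcdz /= -[X in X == _]/((gcdn p `|c k|)%:Z)
       eqz_nat -/(coprime _ _) prime_coprime.
  have /coprimezP[[e f] /= bez] := cop.
  have bez' : e%:~R * (c k)%:~R + f%:~R * p%:R = 1 :> Om.
    by rewrite -[p%:R]/(p%:~R) -!rmorphM -rmorphD /= bez.
  exists (fun i => - e * c i), (e%:~R * r + f%:~R * y).
    by rewrite rpredD // rpredM ?rpred_int.
  rewrite -[LHS]mul1r -[in LHS]bez' mulrDl -mulrA.
  have -> : (c k)%:~R * y = p%:R * r - \sum_(i < k) (c i)%:~R * x i.
    by rewrite -sumE addrC addrK.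
  have eS : \sum_(i < k) (- e * c i)%:~R * x i =
     - e%:~R * \sum_(i < k) (c i)%:~R * x i.
    by rewrite mulr_sumr; apply: eq_bigr => i _; rewrite rmorphM rmorphN mulrA.
  rewrite /= eS.
  by ring.
move=> i; rewrite ltnS leq_eqVlt => /predU1P[->//|].
have [e ckE] := dvdzP dvk.
apply: (xind c (r - e%:~R * y)); first by rewrite rpredB // rpredM ?rpred_int.
rewrite mulrBr -sumE ckE rmorphM /=; rewrite -[p%:R]/(p%:~R); by ring.
Qed.

Lemma pigeonhole_modp : exists N, forall x : nat -> Om, (forall i, x i \in R) ->
  exists i, exists j, [/\ (i < j)%N, (j <= N)%N &
    exists2 r, r \in R & x i - x j = p%:R * r].
Proof.
have [s sR hs] := residues_finite; exists (size s) => x xR.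
have /boolp.choice[g hg] : forall i : nat, exists y, y \in s /\
   exists2 r, r \in R & x i = y + p%:R * r.
  by move=> i; have [|y ys hy] := hs (x i); rewrite ?xR //; exists y.
have [i [j [ltij lej gij]]] : exists i, exists j,
    [/\ (i < j)%N, (j <= size s)%N & g i = g j].
  apply: contrapT => nex.
  have un : uniq [seq g i | i <- iota 0 (size s).+1].
    rewrite map_inj_in_uniq ?iota_uniq // => i j.
    rewrite !mem_iota !add0n !ltnS => lei lej gij.
    by case: (ltngtP i j) => // lt; case: nex; [exists i, j | exists j, i].
  have sub : {subset [seq g i | i <- iota 0 (size s).+1] <= s}.
    by move=> _ /mapP[i _ ->]; have [] := hg i.
  by have := uniq_leq_size un sub; rewrite size_map size_iota ltnn.
have [_ [ri riR xiE]] := hg i; have [_ [rj rjR xjE]] := hg j.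
exists i, j; split=> //; exists (ri - rj); first by rewrite rpredB.
by rewrite xiE xjE gij; ring.
Qed.

(** The exponent [M] is uniform: a factorial absorbs all the periods. *)
Lemma powers_repeat_modp : exists2 M, (0 < M)%N & forall z, z \in R ->
  exists i, exists2 r, r \in R & z ^+ i * (1 - z ^+ M) = p%:R * r.
Proof.
have [N hN] := pigeonhole_modp; exists N`!; first exact: fact_gt0.
move=> z zR; have [i [j [ltij lej [r rR zij]]]] := hN _ (fun i => rpredX i zR).
have /dvdnP[e ->] : (j - i %| N`!)%N.
  by rewrite dvdn_fact // subn_gt0 ltij /= (leq_trans (leq_subr _ _)).
have [w wR wE] : exists2 w, w \in R & 1 - z ^+ (e * (j - i)) = (1 - z ^+ (j - i)) * w.
  exists (\sum_(l < e) (z ^+ (j - i)) ^+ l).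
    by rewrite rpred_sum // => l _; rewrite !rpredX.
  by rewrite mulnC exprM -[RHS]opprK -mulNr opprB -subrX1 opprB.
exists i, (r * w); first by rewrite rpredM.
rewrite wE [LHS]mulrA [RHS]mulrA -zij; congr (_ * _).
by rewrite mulrBr mulr1 -exprD subnKC // ltnW.
Qed.

(** The measure is the number of chosen residues that an ideal contains; it determines
    an ideal containing [p] among those which contain it. *)
Lemma ideal_family_max (C : set (set Om)) :
  (forall I, C I -> [/\ forall x, I x -> x \in R,
     forall x y, I x -> I y -> I (x + y) & forall r, r \in R -> I (p%:R * r)]) ->
  (exists I, C I) ->
  exists2 I, C I & forall J, C J -> I `<=` J -> J `<=` I.
Proof.
move=> hC [I0 CI0]; have [s sR hs] := residues_finite.
pose mu (I : set Om) := count (fun x => `[< I x >]) s.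
pose Q m := `[< exists2 I, C I & mu I = m >].
have Qex : exists m, Q m by exists (mu I0); apply/asboolP; exists I0.
have Qub m : Q m -> (m <= size s)%N by move=> /asboolP[I _ <-]; apply: count_size.
case: (ex_maxnP Qex Qub) => m /asboolP[I CI muI] maxI.
exists I => // J CJ IJ.
have [_ ID IpR] := hC _ CI; have [JR JD JpR] := hC _ CJ.
have muJ : mu J = mu I.
  apply/eqP; rewrite eqn_leq; apply/andP; split.
    by rewrite muI; apply: maxI; apply/asboolP; exists J.
  by apply: sub_count => x /asboolP/IJ Jx; apply/asboolP.
have JI y : y \in s -> J y -> I y.
  move=> ys Jy; apply: contrapT => nIy.
  have : (mu I < mu J)%N; last by rewrite muJ ltnn.
  rewrite /mu -!sumn_count; move: ys; clear -IJ Jy nIy.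
  elim: s => //= z s IHs; rewrite in_cons => /predU1P[<-|ys].
    have -> : `[< I y >] = false by apply/asboolPn.
    have -> : `[< J y >] = true by apply/asboolP.
    rewrite add0n add1n ltnS !sumn_count; apply: sub_count => x /asboolP/IJ Jx.
    exact/asboolP.
  rewrite -addnS leq_add ?IHs //.
  by case: asboolP => [/IJ Jz|//]; case: asboolP.
move=> x Jx; have [y ys [r rR xE]] := hs x (JR x Jx).
rewrite xE; apply: (ID y (p%:R * r)); last exact: IpR.
apply: JI => //; have -> : y = x + p%:R * (- r) by rewrite xE; ring.
by apply: JD => //; apply: JpR; rewrite rpredN.
Qed.

End ResidueFinite.

(** * Prime ideals, their squares and local generators *)

Section Frobenius.
Variables (Om : fieldType) (R : subringClosed Om) (p : nat) (p_pr : prime p).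

Lemma frobenius1 x y : x \in R -> y \in R ->
  exists2 w, w \in R & (x + y) ^+ p = x ^+ p + y ^+ p + p%:R * (x * w).
Proof.
move=> xR yR; have := prime_gt1 p_pr; move: p_pr; case: (p) => [|[|q]] // q_pr _.
have /boolp.choice[c hc] : forall i : 'I_q.+1, exists c : nat,
    'C(q.+2, i.+1) = (q.+2 * c)%N.
  move=> i; have /dvdnP[c ->] : (q.+2 %| 'C(q.+2, i.+1))%N.
    by rewrite prime_dvd_bin //= ltnS ltn_ord.
  by exists c; rewrite mulnC.
exists (\sum_(i < q.+1) x ^+ (q - i) * y ^+ i.+1 *+ c i).
  by rewrite rpred_sum // => i _; rewrite rpredMn // rpredM ?rpredX.
rewrite exprDn big_ord_recl big_ord_recr /= !subn0 !subnn !bin0 binn !mulr1n !expr0.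
rewrite mulr1 mul1r [X in _ + X]addrC addrA; congr (_ + _).
rewrite !mulr_sumr; apply: eq_bigr => i _.
rewrite [bump 0 i]add1n subSS hc mulnC mulrnA -[LHS]mulr_natl; congr (_ * _).
have leiq : (i <= q)%N by rewrite -ltnS.
rewrite (subSn leiq).
rewrite [x ^+ (q - i).+1]exprS.
rewrite -mulrA.
rewrite mulrnAr.
reflexivity.
Qed.

(** The error term is divisible by [p x] and not only by [p]: this makes the middle
    part of a shifted binomial [y ^+ (p ^ k) - c ^+ (p ^ k)] a multiple of the shift. *)
Lemma frobeniusX k x y : x \in R -> y \in R ->
  exists2 w, w \in R & (x + y) ^+ (p ^ k) = x ^+ (p ^ k) + y ^+ (p ^ k) + p%:R * (x * w).
Proof.
move=> xR yR; elim: k => [|k [w wR IH]].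
  by exists 0; rewrite ?rpred0 // !expr1 !mulr0 addr0.
rewrite !expnSr !exprM IH -addrA [_ ^+ _ + _ * _]addrC addrA.
set X := x ^+ (p ^ k); set Y := y ^+ (p ^ k).
have XR : X \in R by rewrite rpredX.
have YR : Y \in R by rewrite rpredX.
have [X' X'R XE] : exists2 X', X' \in R & X = x * X'.
  rewrite /X -(prednK (_ : 0 < p ^ k)%N) ?expn_gt0 ?prime_gt0 //.
  by exists (x ^+ (p ^ k).-1); rewrite ?rpredX // exprS.
have zR : p%:R * (x * w) \in R by rewrite !rpredM ?rpred_nat.
have [w1 w1R E1] := frobenius1 (rpredD XR zR) YR.
have [w2 w2R E2] := frobenius1 zR XR.
have [q qE] : exists q, p = q.+1 by exists p.-1; rewrite prednK ?prime_gt0.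
exists ((X' + p%:R * w) * w1 + w * (p%:R * (x * w)) ^+ q + p%:R * w * w2).
  by rewrite !rpredD ?rpredM ?rpredX ?rpredM ?rpredD ?rpredM ?rpred_nat.
have zE : (p%:R * (x * w)) ^+ p = p%:R * (x * w) * (p%:R * (x * w)) ^+ q.
  by rewrite -exprS -qE.
rewrite E1 (addrC X) E2 zE.
have -> : p%:R * ((p%:R * (x * w) + X) * w1) = p%:R * ((p%:R * (x * w) + x * X') * w1).
  by rewrite -XE.
by move: (X ^+ p) (Y ^+ p) => A B; move: (_ ^+ q) => C; ring.
Qed.

End Frobenius.

(** Ideals are sets of elements of the ambient field, so that a prime of [S] and its
    contraction to a subring [R] live in the same type. *)
Record nonzero_prime (Om : fieldType) (R : {pred Om}) (P : set Om) : Prop := NonzeroPrime {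
  prime_sub : forall x, P x -> x \in R;
  primeD : forall x y, P x -> P y -> P (x + y);
  primeMl : forall r x, r \in R -> P x -> P (r * x);
  prime_not1 : ~ P 1;
  primeM : forall x y, x \in R -> y \in R -> P (x * y) -> P x \/ P y;
  prime_nz : exists2 x, P x & x != 0
}.

Inductive ideal_sq (Om : fieldType) (P : set Om) : set Om :=
  | sq0 : ideal_sq P 0
  | sq_cons x y z : P x -> P y -> ideal_sq P z -> ideal_sq P (x * y + z).

(** The contraction to [R] of the principal ideal generated by [g] in the
    localization of [R] at [P]. *)
Definition loc_multiples (Om : fieldType) (R : {pred Om}) (P : set Om) (g : Om) : set Om :=
  [set h | h \in R /\ exists2 s, s \in R /\ ~ P s & exists2 r, r \in R & s * h = g * r].

Definition locally_principal (Om : fieldType) (R : {pred Om}) (P : set Om) : Prop :=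
  exists2 g, P g & P `<=` loc_multiples R P g.

Section Primes.
Variables (Om : fieldType) (nf : number_field Om) (R : subringClosed Om).
Variables (Rint : {subset R <= @algint Om}) (P : set Om) (hP : nonzero_prime R P).

Lemma prime0 : P 0.
Proof.
by have [x Px _] := prime_nz hP; rewrite -(mul0r x); apply: (primeMl hP); rewrite ?rpred0. Qed.

Lemma primeN x : P x -> P (- x).
Proof. by move=> Px; rewrite -mulN1r; apply: (primeMl hP); rewrite ?rpredN1. Qed.

Lemma primeB x y : P x -> P y -> P (x - y).
Proof. by move=> Px Py; apply: (primeD hP) => //; apply: primeN. Qed.

Lemma primeMr r x : r \in R -> P x -> P (x * r).
Proof. by move=> rR Px; rewrite mulrC; apply: (primeMl hP). Qed.

Lemma primeX n x : P x -> (0 < n)%N -> P (x ^+ n).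
Proof.
by case: n => // n Px _; rewrite exprS; apply: primeMr => //; apply/rpredX/(prime_sub hP). Qed.

Lemma prime_root n x : x \in R -> P (x ^+ n) -> P x.
Proof.
move=> xR; elim: n => [|n IH]; first by rewrite expr0 => /(prime_not1 hP).
by rewrite exprS => /(primeM hP)[] //; rewrite rpredX.
Qed.

Lemma prime_notM x y : x \in R -> y \in R -> ~ P x -> ~ P y -> ~ P (x * y).
Proof. by move=> xR yR nx ny /(primeM hP)[]. Qed.

Lemma prime_notB1 x : P x -> ~ P (1 - x).
Proof. by move=> Px /(primeD hP)/(_ Px); rewrite subrK => /(prime_not1 hP). Qed.

Lemma prime_has_char : exists2 p, prime p & P p%:R.
Proof.
have [x Px x0] := prime_nz hP.
have xR := prime_sub hP Px.
have [N N0 [r rR xr]] := algint_int_multiple xR (Rint xR) x0.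
have : P `|N|%N%:R.
  have : P N%:~R by rewrite -xr; apply: primeMr.
  rewrite {1}[N]intEsign rmorphM rmorphXn /= rmorphN1.
  by case: (_ < _); rewrite ?mul1r // mulN1r => /primeN; rewrite opprK.
have : (0 < `|N|)%N by rewrite absz_gt0.
elim/ltn_ind: {N xr N0}(`|N|%N) => n IH n0 Pn.
have [n1|n1] := leqP n 1.
  by case: (prime_not1 hP); move: Pn; have -> : n = 1%N by apply/eqP; rewrite eqn_leq n1.
have pp := pdiv_prime n1.
have nE := divnK (pdiv_dvd n).
have m0 : (0 < n %/ pdiv n)%N by rewrite divn_gt0 ?pdiv_gt0 // dvdn_leq ?pdiv_dvd.
move: Pn; rewrite -nE natrM => /(primeM hP)[]; rewrite ?rpred_nat // => H.
  by apply: (IH _ _ m0 H); rewrite ltn_Pdiv // prime_gt1.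
by exists (pdiv n).
Qed.

Section Char.
Variables (p : nat) (p_pr : prime p) (Pp : P p%:R).

Lemma prime_charM r : r \in R -> P (p%:R * r).
Proof. by move=> rR; apply: primeMr. Qed.

Lemma prime_natP n : P n%:R <-> (p %| n)%N.
Proof.
split=> [Pn|/dvdnP[k ->]]; last by rewrite natrM; apply: (primeMl hP); rewrite ?rpred_nat.
apply/negPn/negP => ndv.
have n_gt0 : (0 < n)%N by case: n ndv {Pn} => //; rewrite dvdn0.
have cop : coprime n p by rewrite coprime_sym prime_coprime.
have [/= u v E _] := egcdnP p n_gt0.
apply: (prime_not1 hP); move: E; rewrite (eqP cop) => /(congr1 (fun m => m%:R : Om)).
rewrite natrD !natrM => E.
have -> : 1 = u%:R * n%:R - v%:R * p%:R :> Om by rewrite E; ring.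
by apply: primeB; apply: (primeMl hP); rewrite ?rpred_nat.
Qed.

(** The [p]-part of a uniform exponent can be dropped because [x ^+ p ^ e - 1] and
    [(x - 1) ^+ p ^ e] agree modulo [p]. *)
Lemma residue_exponent : exists2 M, (0 < M)%N && coprime p M &
  forall r, r \in R -> ~ P r -> P (r ^+ M - 1).
Proof.
have [M0 M0gt0 hM0] := powers_repeat_modp nf R p_pr.
have [M copM M0E] := pfactor_coprime p_pr M0gt0.
have M_gt0 : (0 < M)%N by move: M0gt0; rewrite M0E muln_gt0 => /andP[].
exists M => [|r rR nPr]; first by rewrite M_gt0.
have [i [w wR E]] := hM0 _ rR.
have PM0 : P (1 - r ^+ M0).
  have : P (r ^+ i * (1 - r ^+ M0)) by rewrite E; apply: prime_charM.
  move/(primeM hP); rewrite rpredX // rpredB ?rpred1 ?rpredX // => -[] // /prime_root.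
  by move=> /(_ rR).
have xR : r ^+ M - 1 \in R by rewrite rpredB ?rpred1 ?rpredX.
have [z zR Ez] := frobeniusX p_pr (logn p M0) xR (rpred1 R).
apply: (@prime_root (p ^ logn p M0)) => //.
move: Ez; rewrite subrK -exprM -M0E expr1n => Ez.
have -> : (r ^+ M - 1) ^+ (p ^ logn p M0) =
   - (1 - r ^+ M0) - p%:R * ((r ^+ M - 1) * z) by rewrite Ez; ring.
by apply: primeB; [apply: primeN | apply: prime_charM; rewrite rpredM].
Qed.

Lemma prime_powX1 r M e : r \in R -> P (r ^+ M - 1) -> P (r ^+ (M * e) - 1).
Proof.
move=> rR PM; rewrite exprM subrX1; apply: primeMr => //.
by rewrite rpred_sum // => i _; rewrite !rpredX.
Qed.

(** All multiples [e] are provided since two different Frobenius powers have to be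
    matched, one for residues of [R] and one for [alpha]. *)
Lemma frobenius_fix : exists2 j, (0 < j)%N &
  forall e r, r \in R -> P (r ^+ (p ^ (j * e)) - r).
Proof.
have [M /andP[M_gt0 copM] hM] := residue_exponent.
exists (totient M) => [|e r rR]; first by rewrite totient_gt0.
have [Pr|nPr] := pselect (P r).
  by apply: primeB => //; apply: primeX; rewrite // expn_gt0 prime_gt0.
have : (M %| p ^ (totient M * e) - 1)%N.
  rewrite -eqn_mod_dvd ?expn_gt0 ?prime_gt0 // expnM.
  by rewrite -modnXm Euler_exp_totient // modnXm exp1n.
case/dvdnP => k kE.
have -> : (p ^ (totient M * e) = (M * k).+1)%N.
  by rewrite [(M * k)%N]mulnC -kE subn1 prednK // expn_gt0 prime_gt0.
rewrite exprS -[X in _ - X]mulr1 -mulrBr; apply: (primeMl hP) => //.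
by apply: prime_powX1 => //; apply: hM.
Qed.

End Char.

(** In a finite residue ring a nonzero element is a root of unity. *)
Lemma prime_maximal s : s \in R -> ~ P s -> exists2 s', s' \in R & P (s' * s - 1).
Proof.
move=> sR nPs; have [p p_pr Pp] := prime_has_char.
have [[|M] // _ hM] := residue_exponent p_pr Pp.
by exists (s ^+ M); rewrite ?rpredX // -exprSr; apply: hM.
Qed.

Lemma sq_sub x : ideal_sq P x -> P x.
Proof.
elim=> [|{}x y z Px Py _ Pz]; first exact: prime0.
by apply: (primeD hP) => //; apply: (primeMl hP) => //; apply: (prime_sub hP).
Qed.

Lemma sq_mul x y : P x -> P y -> ideal_sq P (x * y).
Proof. by move=> Px Py; rewrite -[x * y]addr0; apply: sq_cons => //; apply: sq0. Qed.

Lemma sqD x y : ideal_sq P x -> ideal_sq P y -> ideal_sq P (x + y).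
Proof.
by elim=> [|{}x z t Px Pz _ IH] Sy; rewrite ?add0r // -addrA; apply: sq_cons => //; apply: IH.
Qed.

Lemma sqM r x : r \in R -> ideal_sq P x -> ideal_sq P (r * x).
Proof.
move=> rR; elim=> [|{}x z t Px Pz _ IH]; first by rewrite mulr0; apply: sq0.
by rewrite mulrDr mulrA; apply: sq_cons => //; apply: (primeMl hP).
Qed.

Lemma sqB x y : ideal_sq P x -> ideal_sq P y -> ideal_sq P (x - y).
Proof.
by move=> Sx Sy; apply: sqD => //; rewrite -mulN1r; apply: sqM; rewrite ?rpredN1.
Qed.

Lemma sq_cancel s x : s \in R -> ~ P s -> P x -> ideal_sq P (s * x) -> ideal_sq P x.
Proof.
move=> sR nPs Px Ssx; have [s' s'R Ps'] := prime_maximal sR nPs.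
have -> : x = s' * (s * x) - (s' * s - 1) * x by ring.
by apply: sqB; [apply: sqM | apply: sq_mul].
Qed.

Lemma sqX n x : P x -> (1 < n)%N -> ideal_sq P (x ^+ n).
Proof.
case: n => [|[|n]] // Px _; rewrite exprS; apply: sq_mul => //; exact: primeX.
Qed.

Lemma loc_multiples_self g : g \in R -> loc_multiples R P g g.
Proof.
move=> gR; split=> //; exists 1; first by split; rewrite ?rpred1 //; apply: (prime_not1 hP).
by exists 1; rewrite ?rpred1 // mulrC.
Qed.

Lemma loc_multiplesD g x y :
  loc_multiples R P g x -> loc_multiples R P g y -> loc_multiples R P g (x + y).
Proof.
case=> xR [s [sR ns] [r rR E]] [yR [t [tR nt] [q qR F]]]; split; first exact: rpredD.
exists (s * t); first by split; [rewrite rpredM | apply: prime_notM].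
exists (r * t + q * s); first by rewrite rpredD ?rpredM.
have -> : s * t * (x + y) = (s * x) * t + (t * y) * s by ring.
by rewrite E F; ring.
Qed.

Lemma loc_multiplesM g r x :
  r \in R -> loc_multiples R P g x -> loc_multiples R P g (r * x).
Proof.
move=> rR [xR [s hs [q qR E]]]; split; first exact: rpredM.
by exists s => //; exists (r * q); rewrite ?rpredM // mulrCA E mulrCA.
Qed.

Lemma loc_multiples_saturated g s x : s \in R -> ~ P s -> x \in R ->
  loc_multiples R P g (s * x) -> loc_multiples R P g x.
Proof.
move=> sR ns xR [_ [t [tR nt] [q qR E]]]; split=> //.
exists (t * s); first by split; [rewrite rpredM | apply: prime_notM].
by exists q; rewrite // -mulrA.
Qed.

Lemma locgen_neq0 g : P `<=` loc_multiples R P g -> g != 0.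
Proof.
move=> hg; apply/eqP => g0; have [x Px x0] := prime_nz hP.
have [_ [s [_ ns] [r _]]] := hg x Px; rewrite g0 mul0r => /eqP.
by rewrite mulf_eq0 (negPf x0) orbF => /eqP s0; apply: ns; rewrite s0; apply: prime0.
Qed.

(** Otherwise the generator would be a unit of the localization. *)
Lemma locgen_notin_sq g : P g -> P `<=` loc_multiples R P g -> ~ ideal_sq P g.
Proof.
move=> Pg hg sqg; have g0 := locgen_neq0 hg.
have gR := prime_sub hP Pg.
have : forall x, ideal_sq P x -> exists2 s, s \in R /\ ~ P s &
    exists2 r, r \in R & s * x = g * (g * r).
  move=> x; elim=> [|{}x y z Px Py _ [s [sR ns] [r rR E]]].
    exists 1; first by split; rewrite ?rpred1 //; apply: (prime_not1 hP).
    by exists 0; rewrite ?rpred0 // !mulr0.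
  have [_ [t [tR nt] [q qR F]]] := hg x Px; have [_ [v [vR nv] [w wR G]]] := hg y Py.
  exists (s * (t * v)).
    by split; [rewrite !rpredM | apply: prime_notM; rewrite ?rpredM //; apply: prime_notM].
  exists (q * w * s + r * t * v); first by rewrite rpredD ?rpredM.
  have -> : s * (t * v) * (x * y + z) = s * (t * x) * (v * y) + (s * z) * t * v by ring.
  by rewrite E F G; ring.
move=> /(_ _ sqg)[s [sR ns] [r rR E]]; apply: ns.
have -> : s = g * r by apply: (mulfI g0); rewrite -E mulrC.
exact: primeMr.
Qed.

(** In terms of the given generator [g], [t] is [g] times a local unit. *)
Lemma locgen_of_notin_sq t : locally_principal R P -> P t -> ~ ideal_sq P t ->
  P `<=` loc_multiples R P t.
Proof.
move=> [g Pg hg] Pt nt q Pq; have tR := prime_sub hP Pt.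
have [_ [s [sR ns] [r rR E]]] := hg t Pt.
have nr : ~ P r.
  by move=> Pr; apply: nt; apply: (sq_cancel sR ns Pt); rewrite E; apply: sq_mul.
have [qR [s' [s'R ns'] [r' r'R F]]] := hg q Pq.
split=> //; exists (r * s'); first by split; [rewrite rpredM | apply: prime_notM].
exists (s * r'); first by rewrite rpredM.
have -> : t * (s * r') = (s * t) * r' by ring.
by rewrite -mulrA F E; ring.
Qed.

End Primes.

(** * Local principality and integral closedness *)

Section Overorders.
Variables (Om : fieldType) (nf : number_field Om) (R : subringClosed Om).
Variables (Rint : {subset R <= @algint Om}).

(** The element [y] has the form [r / p]: among the ideals of denominators of such
    elements that lie in [P], a maximal one equals [P].  For [z] in [P] some [w z ^+ i]
    with [w] outside [P] is a denominator of [y]; with [i] minimal,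
    [w z ^+ i.-1 y] has the same denominators, among which is [z]. *)
Lemma inverse_prime (P : set Om) (hP : nonzero_prime R P) : exists y,
  [/\ y \notin R, exists2 p, prime p & p%:R * y \in R & forall x, P x -> x * y \in R].
Proof.
have [p p_pr Pp] := prime_has_char Rint hP.
have p0 := prime_natr_neq0 nf p_pr.
pose den y : set Om := [set x | x \in R /\ x * y \in R].
pose C : set (set Om) := [set I | exists2 y, p%:R * y \in R & I = den y /\ I `<=` P].
have [||I [y pyR [IE IP]] maxI] := @ideal_family_max _ nf R _ p_pr C.
- move=> I [y pyR [-> _]]; split=> [x []//|x z [xR xyR] [zR zyR]|r rR].
    by split; rewrite ?rpredD // mulrDl rpredD.
  by split; [rewrite rpredM ?rpred_nat | rewrite mulrAC rpredM].
- exists (den p%:R^-1), p%:R^-1; first by rewrite divff // rpred1.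
  split=> // x [xR xpR]; rewrite -(divfK p0 x).
  by apply: (primeMl hP).
exists y; split.
- apply/negP => yR; apply: (prime_not1 hP); apply: IP; rewrite IE.
  by split; rewrite ?mul1r ?rpred1.
- by exists p.
move=> z Pz; have zR := prime_sub hP Pz.
(* As [I] is maximal, it suffices to find an element whose denominators contain [I] and
   [z] and lie in [P]. *)
suff: I z by rewrite IE => -[].
have [M M_gt0 hM] := powers_repeat_modp nf R p_pr.
have [i0 [r rR zr]] := hM z zR.
pose Q i := `[< exists2 w, w \in R /\ ~ P w & I (w * z ^+ i) >].
have exQ : exists i, Q i.
  exists i0; apply/asboolP; exists (1 - z ^+ M).
    split; first by rewrite rpredB ?rpred1 ?rpredX.
    exact/(prime_notB1 hP)/(primeX hP).
  rewrite mulrC zr IE; split; first by rewrite rpredM ?rpred_nat.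
  by rewrite mulrAC rpredM.
case: (ex_minnP exQ) => -[|i] /asboolP[w [wR nPw] Iw] mini.
  by case: nPw; move: Iw; rewrite expr0 mulr1 => /IP.
have zwR : w * z ^+ i \in R by rewrite rpredM ?rpredX.
pose y' := w * z ^+ i * y.
have : den y' `<=` I.
  apply: maxI; last first.
    rewrite IE => x [xR xyR]; split=> //.
    by rewrite /y' mulrCA rpredM.
  exists y'; first by rewrite /y' mulrCA rpredM.
  split=> // v [vR vyR]; apply: contrapT => nPv.
  have : (i.+1 <= i)%N; last by rewrite ltnn.
  apply: mini; apply/asboolP; exists (w * v).
    by split; [rewrite rpredM | apply: (prime_notM hP)].
  rewrite IE; split; first by rewrite !rpredM ?rpredX.
  by have -> : w * v * z ^+ i * y = v * y' by rewrite /y'; ring.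
apply; split=> //; move: Iw; rewrite IE => -[_].
by have -> : w * z ^+ i.+1 * y = z * y' by rewrite exprS /y'; ring.
Qed.

(** With [y] from [inverse_prime], either [y P] is not inside [P] and
    [q y] is a local unit for some [q] in [P], or [P] is stable under [y]; then the
    powers of [y] lie in a finitely generated module, and [y] is integral. *)
Lemma locally_principal_of_integrally_closed :
  (forall y N, y \in @algint Om -> (0 < N)%N -> N%:R * y \in R -> y \in R) ->
  forall P, nonzero_prime R P -> locally_principal R P.
Proof.
move=> ic P hP; have [y [yR [p p_pr pyR] hy]] := inverse_prime hP.
have [stab|] := pselect (forall x, P x -> P (x * y)); last first.
  move=> /existsNP[q /not_implyP[Pq nPqy]].
  exists q => // x Px; split; first exact: (prime_sub hP).
  exists (q * y); first by split=> //; apply: hy.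
  by exists (x * y); [apply: hy | ring].
case/negP: yR; apply: (ic y p) => //; last exact: prime_gt0.
have [l l_pr Pl] := prime_has_char Rint hP.
have l0 := prime_natr_neq0 nf l_pr.
have [N hN] := pigeonhole_modp nf R l_pr.
have Py i : P (l%:R * y ^+ i).
  elim: i => [|i IH]; first by rewrite mulr1.
  by rewrite exprSr mulrA; apply: stab.
(* Two powers of [y] agree modulo [R]: their difference, multiplied by [l], is in [l R]. *)
have [i [j [ltij _ [r rR E]]]] := hN _ (fun i => prime_sub hP (Py i)).
have {}E : y ^+ j - y ^+ i + r = 0.
  by apply: (mulfI l0); rewrite mulr0 mulrDr -E; ring.
apply/algintP; apply: (@integral_root_monic _ _ _ y ('X^j + (- 'X^i + r%:P))).
- apply/monicP; rewrite lead_coefDl ?lead_coefXn // size_polyXn.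
  rewrite (leq_ltn_trans (size_polyD _ _)) // gtn_max size_polyN size_polyXn ltnS ltij /=.
  by rewrite (leq_ltn_trans (size_polyC_leq1 _)) // ltnS (leq_ltn_trans _ ltij).
- by rewrite rootE !(hornerD, hornerN, hornerXn, hornerC) addrA E.
apply/integral_poly => k.
have : ('X^j + (- 'X^i + r%:P) : {poly Om}) \is a polyOver (@algint Om).
  by rewrite !rpredD ?rpredN ?rpredX ?polyOverX // polyOverC Rint.
by move/polyOverP/(_ k)/algintP.
Qed.

(** If [p x] is in [R] and [x] is not, a maximal ideal of denominators of multiples of
    [x] is prime.  Let [z] be the corresponding multiple and [g] a local generator of
    this prime: [g z] outside it contradicts the integrality of [z], and [g z]
    inside it makes [z] lie in the localization. *)
Lemma integrally_closed_of_locally_principal :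
  (forall P, nonzero_prime R P -> locally_principal R P) ->
  forall y N, y \in @algint Om -> (0 < N)%N -> N%:R * y \in R -> y \in R.
Proof.
move=> lp y N yint; elim/ltn_ind: N => N IH N0 NyR.
have [N1|N1] := leqP N 1.
  move: NyR; have -> : N = 1%N by apply/eqP; rewrite eqn_leq N1.
  by rewrite mul1r.
have p_pr := pdiv_prime N1; set p := pdiv N in p_pr.
have m0 : (0 < N %/ p)%N by rewrite divn_gt0 ?pdiv_gt0 // dvdn_leq ?pdiv_dvd.
apply: (IH _ _ m0); first by rewrite ltn_Pdiv // prime_gt1.
set x := (N %/ p)%:R * y.
have xint : x \in @algint Om by rewrite rpredM ?rpred_nat.
have pxR : p%:R * x \in R by rewrite mulrA -natrM mulnC divnK ?pdiv_dvd.
move: x xint pxR => {N0 NyR IH N1 m0 yint} x xint pxR.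
apply: contrapT => nxR.
pose den y : set Om := [set x | x \in R /\ x * y \in R].
pose C : set (set Om) := [set I | exists2 r, r \in R & r * x \notin R /\ I = den (r * x)].
have [||I [r rR [nrx IE]] maxI] := @ideal_family_max _ nf R _ p_pr C.
- move=> I [r rR [_ ->]]; split=> [z []//|z t [zR zyR] [tR tyR]|t tR].
    by split; rewrite ?rpredD // mulrDl rpredD.
  split; first by rewrite rpredM ?rpred_nat.
  have -> : p%:R * t * (r * x) = t * r * (p%:R * x) by ring.
  exact: rpredM (rpredM tR rR) pxR.
- by exists (den (1 * x)), 1; rewrite ?rpred1 // mul1r; split=> //; apply/negP.
set z := r * x in nrx IE.
have zint : z \in @algint Om by apply: rpredM xint; apply: Rint.
have hI : nonzero_prime R I.
  rewrite IE; split.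
  - by move=> ? [].
  - by move=> s t [sR szR] [tR tzR]; split; rewrite ?rpredD // mulrDl rpredD.
  - by move=> s t sR [tR tzR]; split; [rewrite rpredM | rewrite -mulrA rpredM].
  - by case=> _; rewrite mul1r; apply/negP.
  - move=> s t sR tR [_ stzR]; have [szR|szR] := boolP (s * z \in R); [by left | right].
    rewrite -IE; apply: (maxI (den (s * r * x))).
    + exists (s * r); first by rewrite rpredM.
      by split=> //; rewrite -mulrA.
    + rewrite IE => v [vR vzR]; split=> //.
      by have -> : v * (s * r * x) = s * (v * z); [rewrite /z; ring | exact: rpredM].
    + by split=> //; have -> : t * (s * r * x) = s * t * z by rewrite /z; ring.
  - exists p%:R; last exact: prime_natr_neq0.
    by split; rewrite ?rpred_nat // /z mulrCA rpredM.
have [g Ig hg] := lp I hI.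
have g0 := locgen_neq0 hI hg.
have gzR : g * z \in R by move: Ig; rewrite IE => -[].
have [Iw|nIw] := pselect (I (g * z)).
  have [_ [s [sR ns] [t tR E]]] := hg _ Iw.
  apply: ns; rewrite IE; split=> //.
  by have -> : s * z = t by apply: (mulfI g0); rewrite -E mulrCA.
apply: nIw; have /algintP[q qmon qz] := zint.
set qq := map_poly _ q in qz; have qqmon : qq \is monic by apply: monic_map.
have [n sz] : exists n, size qq = n.+1.
  by exists (size qq).-1; rewrite prednK // size_poly_gt0 monic_neq0.
apply: (@prime_root _ _ _ hI n) => //.
have qn : qq`_n = 1 by move/monicP: qqmon; rewrite lead_coefE sz.
move: qz; rewrite rootE horner_coef sz big_ord_recr /= qn mul1r => /eqP qz.
have -> : (g * z) ^+ n = g * - \sum_(i < n) qq`_i * (g * z) ^+ i * g ^+ (n - i.+1).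
  have zn : z ^+ n = - \sum_(i < n) qq`_i * z ^+ i.
    by apply/eqP; rewrite -addr_eq0 addrC qz.
  rewrite exprMn zn !mulrN; congr (- _); rewrite !mulr_sumr; apply: eq_bigr => i _.
  have -> : g ^+ n = g ^+ i * g * g ^+ (n - i.+1) by rewrite -exprSr -exprD subnKC.
  by rewrite [(g * z) ^+ i]exprMn; ring.
apply: (primeMr hI) => //; rewrite rpredN rpred_sum // => i _.
have gR := prime_sub hI Ig.
apply: rpredM; last exact: rpredX.
by apply: rpredM; [rewrite coef_map rpred_int | exact: rpredX].
Qed.

(** Clearing denominators in an integral equation of [1 / p] shows that [p] divides 1. *)
Lemma prime_inverse_not_algint p (r : Om) : prime p -> r \in @algint Om -> p%:R * r <> 1.
Proof.
move=> p_pr /algintP[q qmon qr] E.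
have intr0 (z : int) : z%:~R = 0 :> Om -> z = 0.
  case: z => n; first by rewrite -[LHS]/(n%:R) => /eqP; rewrite nf.1 => /eqP->.
  by rewrite NegzE rmorphN /= => /eqP; rewrite oppr_eq0 -[_%:~R]/(n.+1%:R) nf.1.
have [n sz] : exists n, size q = n.+1.
  by exists (size q).-1; rewrite prednK // size_poly_gt0 monic_neq0.
have qn : q`_n = 1 by move/monicP: qmon; rewrite lead_coefE sz.
have szq : (size (map_poly (intr : int -> Om) q) <= n.+1)%N by rewrite -sz size_poly.
move: qr; rewrite rootE (horner_coef_wide _ szq).
rewrite big_ord_recr /= coef_map /= qn mulr1z mul1r => /eqP qr.
have : (p%:Z * \sum_(i < n) q`_i * p%:Z ^+ (n - i.+1) + 1)%:~R = 0 :> Om.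
  rewrite -[RHS](mulr0 (p%:R ^+ n)) -[X in _ = _ * X]qr mulrDr -exprMn E expr1n.
  rewrite rmorphD rmorphM /= mulr1z.
  congr (_ + _); rewrite rmorph_sum !mulr_sumr; apply: eq_bigr => i _ /=.
  rewrite coef_map rmorphM rmorphXn /= -[p%:~R]/(p%:R).
  have -> : p%:R ^+ n = p%:R ^+ i * p%:R * p%:R ^+ (n - i.+1) :> Om.
    by rewrite -exprSr -exprD subnKC.
  have Ei : p%:R ^+ i * r ^+ i = 1 :> Om by rewrite -exprMn E expr1n.
  rewrite -[LHS]mulr1 -[X in _ * X = _]Ei.
  by move: (p%:R ^+ (n - i.+1)) (p%:R ^+ i) (r ^+ i) => G A B; ring.
move/intr0; set S := \sum_(i < n) _ => H.
have : (p%:Z %| 1)%Z.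
  apply/dvdzP; exists (- S); rewrite mulNr mulrC.
  by apply/eqP; rewrite -addr_eq0 addrC H.
by rewrite dvdzE /= dvdn1 => /eqP p1; rewrite p1 in p_pr.

Qed.

(** A maximal proper ideal containing [p] is prime. *)
Lemma prime_over p : prime p -> exists2 P, nonzero_prime R P & P p%:R.
Proof.
move=> p_pr; have p0 := prime_natr_neq0 nf p_pr.
pose C : set (set Om) := [set I | [/\ forall x, I x -> x \in R,
   forall x y, I x -> I y -> I (x + y), forall r x, r \in R -> I x -> I (r * x),
   ~ I 1 & I p%:R]].
have [||I [IR ID IM I1 Ip] maxI] := @ideal_family_max _ nf R _ p_pr C.
- by move=> I [IR ID IM _ Ip]; split=> // r rR; rewrite mulrC; apply: IM.
- exists [set x | exists2 r, r \in R & x = p%:R * r]; split.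
  + by move=> _ [r rR ->]; rewrite rpredM ?rpred_nat.
  + by move=> _ _ [r rR ->] [s sR ->]; exists (r + s); rewrite ?rpredD // mulrDr.
  + by move=> r _ rR [s sR ->]; exists (r * s); rewrite ?rpredM // mulrCA.
  + by case=> r rR /esym; apply: prime_inverse_not_algint => //; apply: Rint.
  + by exists 1; rewrite ?rpred1 ?mulr1.
exists I => //; split=> //.
  move=> x y xR yR Ixy; have [Ix|nIx] := pselect (I x); [by left | right].
  pose J : set Om := [set z | exists i, exists2 r, I i /\ r \in R & z = i + r * x].
  have IJ : I `<=` J by move=> i Ii; exists i, 0; rewrite ?rpred0 // mul0r addr0.
  have Jx : J x.
    exists (0 * x), 1; last by rewrite mul1r mul0r add0r.
    by split; rewrite ?rpred1 // mul0r -(mul0r p%:R); apply: IM; rewrite ?rpred0.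
  have [[i [r [Ii rR] E]]|nJ1] := pselect (J 1).
    have -> : y = y * i + r * (x * y) by rewrite -[LHS]mulr1 E; ring.
    by apply: ID; apply: IM.
  case: nIx; apply: (maxI J) => //; split=> //.
  - by move=> _ [i [r [Ii rR] ->]]; apply: rpredD (IR _ Ii) _; apply: rpredM.
  - move=> _ _ [i [r [Ii rR] ->]] [j [s [Ij sR] ->]].
    by exists (i + j), (r + s); [split; [apply: ID | rewrite rpredD] | ring].
  - move=> s _ sR [i [r [Ii rR] ->]].
    by exists (s * i), (s * r); [split; [apply: IM | rewrite rpredM] | ring].
  - exact: IJ.
by exists p%:R.
Qed.

End Overorders.

(** * Adjoining a d-th root *)

Section ResidueRoot.
Variables (Om : fieldType) (nf : number_field Om) (R : subringClosed Om).
Variables (Rint : {subset R <= @algint Om}) (P : set Om) (hP : nonzero_prime R P).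

(** Residue fields are perfect. *)
Lemma residue_root p k t : prime p -> P p%:R -> t \in R ->
  exists2 c, c \in R & P (t - c ^+ (p ^ k)).
Proof.
move=> p_pr Pp tR; have [j j_gt0 hj] := frobenius_fix nf hP p_pr Pp.
exists (t ^+ (p ^ (j * k - k))); first exact: rpredX.
rewrite -exprM -expnD subnK; last by rewrite leq_pmull.
by rewrite -opprB; apply/(primeN hP)/hj.
Qed.

(** The intersection of the powers of [P] is zero: [r] divides some [m p ^ a], and [p]
    divides locally a power of [g] because [g ^+ i * (1 - g ^+ M)] is in [p R]. *)
Lemma not_tau_divisible g r : P g -> r \in R -> r != 0 ->
  exists j, forall s x, s \in R -> ~ P s -> x \in R -> s * r <> g ^+ j * x.
Proof.
move=> Pg rR r0; have gR := prime_sub hP Pg.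
have [p p_pr Pp] := prime_has_char Rint hP.
have [M M_gt0 hM] := powers_repeat_modp nf R p_pr.
have [i [z zR E]] := hM g gR.
have [g0|g0] := eqVneq g 0.
  exists 1%N => s x sR ns xR; rewrite g0 expr1 mul0r => /eqP.
  rewrite mulf_eq0 (negPf r0) orbF => /eqP s0; apply: ns; rewrite s0.
  exact: (prime0 hP).
have [N N0 [y yR ry]] := algint_int_multiple rR (Rint rR) r0.
have n0 : (0 < `|N|)%N by rewrite absz_gt0.
have [y' y'R ry'] : exists2 y', y' \in R & r * y' = `|N|%N%:R.
  have [N_ge0|N_lt0] := lerP 0 N.
    by exists y => //; rewrite ry -{1}(gez0_abs N_ge0).
  exists (- y); first by rewrite rpredN.
  by rewrite mulrN ry -[`|N|%N%:R]/((Posz `|N|)%:~R) ltz0_abs // rmorphN.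
have [m copm nE] := pfactor_coprime p_pr n0; set a := logn p _ in nE.
(* Here [`|N| = m * p ^ a] with [m] prime to [p], so [m] is a local unit. *)
have nPm : ~ P m%:R.
  by move/(prime_natP hP p_pr Pp); apply/negP; rewrite -prime_coprime.
exists (i * a).+1 => s x sR ns xR sr.
set e := 1 - g ^+ M.
have ne : ~ P e by apply/(prime_notB1 hP)/(primeX hP).
have eR : e \in R by rewrite rpredB ?rpred1 ?rpredX.
have : P (s * m%:R * e ^+ a).
  have -> : s * m%:R * e ^+ a = g * (x * y' * z ^+ a).
    have pa0 : p%:R ^+ a != 0 :> Om by rewrite expf_neq0 // prime_natr_neq0.
    have F : g ^+ (i * a) * e ^+ a = p%:R ^+ a * z ^+ a by rewrite exprM -!exprMn E.
    have G : s * (m%:R * p%:R ^+ a) = g * g ^+ (i * a) * x * y'.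
      by rewrite -natrX -natrM -nE -ry' mulrA sr exprS.
    apply: (mulfI pa0).
    have -> : p%:R ^+ a * (s * m%:R * e ^+ a) = s * (m%:R * p%:R ^+ a) * e ^+ a.
      by move: (p%:R ^+ a) (e ^+ a) => A B; ring.
    have -> : p%:R ^+ a * (g * (x * y' * z ^+ a)) = g * x * y' * (p%:R ^+ a * z ^+ a).
      by move: (p%:R ^+ a) (z ^+ a) => A B; ring.
    rewrite G -F; move: (g ^+ _) (e ^+ a) => A B; ring.
  by apply: (primeMr hP); rewrite // !rpredM ?rpredX.
apply: (prime_notM hP); rewrite ?rpredM ?rpredX ?rpred_nat //.
  by apply: (prime_notM hP); rewrite ?rpred_nat.
by move/(prime_root hP eR).
Qed.

End ResidueRoot.

Section Extension.
Variables (Om : fieldType) (nf : number_field Om) (R S : subringClosed Om).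
Variables (RS : {subset R <= S}) (Sint : {subset S <= @algint Om}).

Lemma prime_contraction Q : nonzero_prime S Q -> nonzero_prime R [set x | x \in R /\ Q x].
Proof.
move=> hQ; split=> /=.
- by move=> x [].
- by move=> x y [xR Qx] [yR Qy]; split; [rewrite rpredD | apply: (primeD hQ)].
- by move=> r x rR [xR Qx]; split; [rewrite rpredM | apply: (primeMl hQ); rewrite // RS].
- by case=> _ /(prime_not1 hQ).
- move=> x y xR yR [_ /(primeM hQ)[]]; rewrite // ?RS //; by [left | right].
- have [p p_pr Qp] := prime_has_char Sint hQ.
  by exists p%:R; [split; rewrite ?rpred_nat | apply: prime_natr_neq0].
Qed.

Variables (Q : set Om) (hQ : nonzero_prime S Q).
Let P : set Om := [set x | x \in R /\ Q x].
Let hP : nonzero_prime R P := prime_contraction hQ.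
Let Rint : {subset R <= @algint Om}.
Proof. by move=> x /RS/Sint. Qed.

Lemma contraction_not s : s \in R -> ~ P s -> ~ Q s.
Proof. by move=> sR nPs Qs; apply: nPs. Qed.

(** A local generator of [P] which is a multiple of [g] in [S] places all of [P]
    among the local multiples of [g] at [Q]. *)
Lemma loc_multiples_lift g h tau q : tau = g * h -> h \in S ->
  loc_multiples R P tau q -> loc_multiples S Q g q.
Proof.
move=> -> hS [qR [s [sR ns] [r rR E]]]; split; first exact: RS.
exists s; first by split; [apply: RS | apply: contraction_not].
by exists (h * r); [exact: rpredM hS (RS rR) | rewrite E mulrA].
Qed.

(** Ramification: [P] lies in the square of [Q] as soon as a local generator of [P]
    is a product of two elements of [Q]. *)
Lemma sq_lift g h tau q : tau = g * h -> Q g -> Q h ->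
  loc_multiples R P tau q -> P q -> ideal_sq Q q.
Proof.
move=> -> Qg Qh [qR [s [sR ns] [r rR E]]] [_ Qq].
apply: (sq_cancel nf Sint hQ (RS sR)) => //; first exact: contraction_not.
by rewrite E mulrC; apply: (sqM hQ); rewrite // ?RS //; apply: sq_mul.
Qed.

Section Independence.
Variables (g tau s1 s2 : Om) (n : nat).
Hypotheses (Qg : Q g) (g0 : g != 0) (Ptau : P tau) (tauP : P `<=` loc_multiples R P tau).
Hypotheses (s1S : s1 \in S) (s2S : s2 \in S) (ns2 : ~ Q s2).
Hypothesis g_tau : s2 * tau = g ^+ n * s1.

Let tau_lift q : P q -> loc_multiples S Q (g ^+ n) q.
Proof.
move=> Pq; have [qR [s [sR ns] [r rR E]]] := tauP Pq.
split; first exact: RS.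
exists (s2 * s).
  split; first by rewrite rpredM // RS.
  by apply: (prime_notM hQ); rewrite // ?RS //; apply: contraction_not.
exists (s1 * r); first by rewrite rpredM // ?RS.
by rewrite -mulrA E mulrA g_tau mulrA.
Qed.

(** In a relation with lower coefficients in [P], these contribute multiples of
    [g ^+ n]; division by [g ^+ i] leaves the [i]-th coefficient modulo [g]. *)
Let relation_in_P (r : nat -> Om) : (forall i, r i \in R) ->
  \sum_(i < n) r i * g ^+ i = 0 -> forall i, (i < n)%N -> P (r i).
Proof.
move=> rR rel; elim/ltn_ind=> i IH ltin.
have gS := prime_sub hQ Qg.
move: rel; rewrite -(big_mkord predT (fun i => r i * g ^+ i)) /=.
rewrite (big_cat_nat (leq0n i.+1) ltin) /= big_nat_recr //=.
rewrite -{1}(add0n i.+1) big_addn.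
have -> : \sum_(0 <= l < n - i.+1) r (l + i.+1)%N * g ^+ (l + i.+1) =
   g ^+ i * (g * \sum_(0 <= l < n - i.+1) r (l + i.+1)%N * g ^+ l).
  by rewrite !mulr_sumr; apply: eq_bigr => l _; rewrite exprD exprS; ring.
set A := \sum_(0 <= l < i) _; set B := \sum_(0 <= l < _) _.
have BS : B \in S by rewrite rpred_sum // => l _; rewrite rpredM ?rpredX // ?RS.
have : loc_multiples S Q (g ^+ n) A.
  rewrite /A big_nat.
  elim/big_ind: _ => [||l /andP[_ ltli]].
  - split; rewrite ?rpred0 //; exists 1.
      by split; rewrite ?rpred1 //; apply: (prime_not1 hQ).
    by exists 0; rewrite ?rpred0 // !mulr0.
  - exact: (loc_multiplesD hQ).
  - rewrite mulrC; apply: loc_multiplesM; first exact: rpredX.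
    by apply: tau_lift; apply: IH => //; apply: ltn_trans ltin.
case=> _ [s [sS ns] [y yS E]] rel.
have Qsr : Q (s * r i).
  have -> : s * r i = g * (- (g ^+ (n - i.+1) * y) - s * B).
    apply: (mulfI (expf_neq0 i g0)).
    have gn : g ^+ n = g ^+ i * g * g ^+ (n - i.+1) by rewrite -exprSr -exprD subnKC.
    apply/eqP; rewrite -subr_eq0; apply/eqP.
    have -> : g ^+ i * (s * r i) - g ^+ i * (g * (- (g ^+ (n - i.+1) * y) - s * B)) =
      s * (A + r i * g ^+ i + g ^+ i * (g * B)) - s * A + g ^+ n * y by rewrite gn; ring.
    by rewrite rel E; ring.
  by apply: (primeMr hQ) => //; rewrite rpredB ?rpredN ?rpredM ?rpredX.
split=> //; move: Qsr => /(primeM hQ)[] //; exact: RS.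
Qed.

Let common_denominator (r : nat -> Om) m : (forall i, r i \in R) ->
  (forall i, (i < m)%N -> P (r i)) ->
  exists2 s, s \in R /\ ~ P s & exists2 r', (forall i, r' i \in R) &
    forall i, (i < m)%N -> s * r i = tau * r' i.
Proof.
move=> rR; elim: m => [_|m IH hr].
  exists 1; first by split; rewrite ?rpred1 //; apply: (prime_not1 hP).
  by exists (fun=> 0) => // i; rewrite rpred0.
have [|s [sR ns] [r' r'R E]] := IH; first by move=> i lti; apply: hr; apply: ltnW.
have [_ [s' [s'R ns'] [x xR F]]] := tauP (hr m (ltnSn m)).
exists (s' * s); first by split; [rewrite rpredM | apply: (prime_notM hP)].
exists (fun i => if i == m then x * s else s' * r' i).
  by move=> i; case: eqP => _; rewrite rpredM.
move=> i; rewrite ltnS leq_eqVlt; case: eqP => [-> _|_ /= ltim].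
  by rewrite mulrAC F mulrA.
by rewrite -mulrA E // mulrCA.
Qed.

(** Infinite descent: all coefficients of a relation lie in [P], so they can be divided
    by [tau] after multiplication by a common local unit, and nonzero elements are
    not divisible by all powers of [tau]. *)
Lemma powers_independent (r : nat -> Om) : (forall i, r i \in R) ->
  \sum_(i < n) r i * g ^+ i = 0 -> forall i, (i < n)%N -> r i = 0.
Proof.
move=> rR rel i ltin; apply/eqP; apply: contraT => ri0.
have tau0 := locgen_neq0 hP tauP.
have [j hj] := not_tau_divisible nf Rint hP Ptau (rR i) ri0.
have [s [sR ns] [x xR E]] : exists2 s, s \in R /\ ~ P s &
    exists2 x, x \in R & s * r i = tau ^+ j * x.
  elim: j r rR rel {ri0 hj} => [|j IH] r rR rel.
    exists 1; first by split; rewrite ?rpred1 //; apply: (prime_not1 hP).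
    by exists (r i); rewrite // expr0.
  have [s [sR ns] [r' r'R E]] := common_denominator rR (relation_in_P rR rel).
  have rel' : \sum_(l < n) r' l * g ^+ l = 0.
    apply: (mulfI tau0); rewrite mulr0 -[RHS](mulr0 s) -[X in _ = _ * X]rel !mulr_sumr.
    by apply: eq_bigr => l _; rewrite mulrA -E // -mulrA.
  have [s' [s'R ns'] [x xR F]] := IH r' r'R rel'.
  exists (s' * s); first by split; [rewrite rpredM | apply: (prime_notM hP)].
  exists x => //; rewrite -mulrA E // mulrCA F exprS; ring.
by case: (hj s x).
Qed.

End Independence.

Variables (alpha t : Om) (d : nat).
Hypotheses (aS : alpha \in S) (tR : t \in R) (d_gt1 : (1 < d)%N) (alphaX : alpha ^+ d = t).
Hypothesis S_gen : forall x, x \in S -> exists2 q, q \is a polyOver R & x = q.[alpha].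
Hypothesis lpP : locally_principal R P.
Hypothesis tame : ~ P d%:R -> ~ ideal_sq P t.
Hypothesis wild : forall p, prime p -> P p%:R -> (p %| d)%N ->
  forall c, c \in R -> ~ ideal_sq P (t - c ^+ p).

(** For [d] in [P] this is the case [c = 0] of the condition on [p]-th powers. *)
Lemma t_notin_sq : ~ ideal_sq P t.
Proof.
have [/= Pd|] := pselect (P d%:R); last exact: tame.
have [p p_pr Pp] := prime_has_char Rint hP.
have := wild p_pr Pp (proj1 (prime_natP hP p_pr Pp d) Pd) (rpred0 R).
by rewrite expr0n gtn_eqF ?prime_gt0 // subr0.
Qed.

(** Let [J] be the ideal of local multiples of [g].  The elements [h] of [S] with
    [h ^+ n - h] in [J], for [n] a suitable power of [p], form a ring that contains
    [R] and [alpha], hence all of [S].  For [h] in [Q] the factor [1 - h ^+ n.-1] is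
    a local unit, so [h] itself is in [J]. *)
Lemma locgen_extension g p : prime p -> P p%:R -> Q g -> P `<=` loc_multiples S Q g ->
  loc_multiples S Q g alpha \/
  (exists2 M, (0 < M)%N && coprime p M & loc_multiples S Q g (alpha ^+ M - 1)) ->
  Q `<=` loc_multiples S Q g.
Proof.
move=> p_pr Pp Qg PJ hM; set J := loc_multiples S Q g.
have [j j_gt0 hj] := frobenius_fix nf hP p_pr Pp.
have [e e_gt0 he] : exists2 e, (0 < e)%N & J (alpha ^+ (p ^ (j * e)) - alpha).
  have E n : (0 < n)%N -> alpha ^+ n - alpha = alpha * (alpha ^+ n.-1 - 1).
    by move=> n_gt0; rewrite mulrBr -exprS prednK // mulr1.
  case: hM => [Ja|[M /andP[M_gt0 copM] JM]].
    exists 1%N => //; rewrite E ?expn_gt0 ?prime_gt0 // mulrC.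
    by apply: loc_multiplesM; rewrite // rpredB ?rpred1 ?rpredX.
  exists (totient M); first by rewrite totient_gt0.
  rewrite E ?expn_gt0 ?prime_gt0 //; apply: loc_multiplesM => //.
  have /dvdnP[k ->] : (M %| (p ^ (j * totient M)).-1)%N.
    rewrite -subn1 -eqn_mod_dvd ?expn_gt0 ?prime_gt0 // mulnC expnM.
    by rewrite -modnXm Euler_exp_totient // modnXm exp1n.
  rewrite mulnC exprM subrX1 mulrC; apply: loc_multiplesM => //.
  by rewrite rpred_sum // => i _; rewrite !rpredX.
set n := (p ^ (j * e))%N in he.
have n_gt1 : (1 < n)%N.
  by rewrite -(exp1n (j * e)) ltn_exp2r ?prime_gt1 // muln_gt0 j_gt0.
have JD x y : J x -> J y -> J (x + y) by apply: (loc_multiplesD hQ).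
have JM x y : x \in S -> J y -> J (x * y) by apply: loc_multiplesM.
pose T x := x \in S /\ J (x ^+ n - x).
have TD x y : T x -> T y -> T (x + y).
  move=> [xS Tx] [yS Ty]; split; first exact: rpredD.
  (* Additivity of the Frobenius, as [p] is in [J]. *)
  have [w wS ->] := frobeniusX p_pr (j * e) xS yS.
  rewrite -/n; have -> : x ^+ n + y ^+ n + p%:R * (x * w) - (x + y) =
    (x ^+ n - x) + (y ^+ n - y) + (x * w) * p%:R by ring.
  by apply/JD/JM/PJ; rewrite ?rpredM //; apply: JD.
have TM x y : T x -> T y -> T (x * y).
  move=> [xS Tx] [yS Ty]; split; first exact: rpredM.
  have -> : (x * y) ^+ n - x * y = x ^+ n * (y ^+ n - y) + y * (x ^+ n - x).
    by rewrite exprMn; ring.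
  by apply: JD; apply: JM; rewrite ?rpredX.
have TR x : x \in R -> T x.
  by move=> xR; split; [apply: RS | apply/PJ/hj].
have Ta : T alpha by [].
have TX k : T (alpha ^+ k).
  elim: k => [|k IH]; first by rewrite expr0; apply: TR; rewrite rpred1.
  by rewrite exprS; apply: TM.
have TS x : x \in S -> T x.
  move=> /S_gen[q /polyOverP qR ->]; rewrite horner_coef.
  elim/big_ind: _ => [||i _]; [by apply: TR; rewrite rpred0 | exact: TD |].
  exact: TM (TR _ (qR i)) (TX i).
move=> h Qh; have hS := prime_sub hQ Qh; have [_ Th] := TS h hS.
have Ph : Q (h ^+ n.-1) by apply: (primeX hQ) => //; rewrite -ltnS prednK // ltnW.
apply: (@loc_multiples_saturated _ _ _ hQ g (1 - h ^+ n.-1) h) => //.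
- by rewrite rpredB ?rpred1 ?rpredX.
- exact: (prime_notB1 hQ).
have -> : (1 - h ^+ n.-1) * h = -1 * (h ^+ n - h).
  by rewrite -{2}(prednK (ltnW n_gt1)) exprSr; ring.
by apply: JM; rewrite ?rpredN1.
Qed.

(** Expanding [alpha ^+ d = ((alpha ^+ m - c) + c) ^+ (p ^ k)] expresses
    [t - c ^+ (p ^ k)] by [g = alpha ^+ m - c] as in an Eisenstein equation, and
    [c ^+ (p ^ k)] is a [p]-th power. *)
Lemma eisenstein_shift p k m : prime p -> P p%:R -> d = (p ^ k * m)%N -> (0 < k)%N ->
  exists2 c, c \in R & exists2 w, w \in S & let g := alpha ^+ m - c in
    [/\ Q g, P (t - c ^+ (p ^ k)), ~ ideal_sq P (t - c ^+ (p ^ k))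
      & t - c ^+ (p ^ k) = g * (g ^+ (p ^ k).-1 + p%:R * w)].
Proof.
move=> p_pr Pp dE k_gt0; have [c cR Pc] := residue_root nf hP k p_pr Pp tR.
exists c => //; set g := alpha ^+ m - c.
have gS : g \in S by rewrite rpredB ?rpredX // ?RS.
have [w wS E] := frobeniusX p_pr k gS (RS cR).
have n_gt0 : (0 < p ^ k)%N by rewrite expn_gt0 prime_gt0.
have tauE : t - c ^+ (p ^ k) = g * (g ^+ (p ^ k).-1 + p%:R * w).
  rewrite mulrDr -exprS prednK // -alphaX dE mulnC exprM.
  by rewrite -[X in X ^+ (p ^ k)](subrK c) -/g E; ring.
exists w => //; split=> //.
  apply: (@prime_root _ _ _ hQ (p ^ k)) => //.
  have -> : g ^+ (p ^ k) = t - c ^+ (p ^ k) - p%:R * (g * w).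
    by rewrite tauE -{1}(prednK n_gt0) exprS; ring.
  apply: (primeB hQ); first by case: Pc.
  by apply: (primeMr hQ); rewrite ?rpredM //; case: Pp.
rewrite -(prednK k_gt0) expnSr exprM; apply: wild; rewrite ?rpredX //.
by rewrite dE -(prednK k_gt0) expnS -mulnA dvdn_mulr.
Qed.

(** The generator has the form [alpha ^+ m - c] with [c] in [R] in both ramified cases
    ([m = 1] and [c = 0] when [t] is in [P]), which is what the inheritance of the
    condition on [p]-th powers uses. *)
Lemma ramified_case : P t \/ P d%:R ->
  exists g m c, [/\ g = alpha ^+ m - c, c \in R, Q g, Q `<=` loc_multiples S Q g &
     P `<=` ideal_sq Q /\ (P t -> g = alpha)].
Proof.
have [p p_pr Pp] := prime_has_char Rint hP.
have [Pt _|nPt] := pselect (P t).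
  exists alpha, 1%N, 0; have Qa : Q alpha.
    by apply: (@prime_root _ _ _ hQ d); rewrite // alphaX; case: Pt.
  have tE : t = alpha * alpha ^+ d.-1 by rewrite -exprS prednK // ltnW.
  have tP := locgen_of_notin_sq nf Rint hP lpP Pt t_notin_sq.
  split; rewrite ?expr1 ?subr0 ?rpred0 //.
    apply: (locgen_extension p_pr) => //.
      by move=> q Pq; apply: (loc_multiples_lift tE); rewrite ?rpredX //; apply: tP.
    by left; apply: loc_multiples_self.
  split=> // q Pq; apply: (sq_lift tE) => //; last exact: tP.
  by apply: (primeX hQ) => //; rewrite -ltnS prednK // ltnW.
case=> // /(prime_natP hP p_pr Pp) pd.
have d_gt0 : (0 < d)%N by apply: ltnW.
have [m copm dE] := pfactor_coprime p_pr d_gt0.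
have k_gt0 : (0 < logn p d)%N by rewrite logn_gt0 mem_primes p_pr d_gt0.
rewrite mulnC in dE.
have [c cR [w wS [Qg Ptau ntau tauE]]] := eisenstein_shift p_pr Pp dE k_gt0.
set k := logn p d in k_gt0 dE Ptau ntau tauE; set g := alpha ^+ m - c in Qg tauE.
have gS := prime_sub hQ Qg.
have tauP := locgen_of_notin_sq nf Rint hP lpP Ptau ntau.
have hS : g ^+ (p ^ k).-1 + p%:R * w \in S by rewrite rpredD ?rpredM ?rpredX ?rpred_nat.
have m_gt0 : (0 < m)%N by move: d_gt0; rewrite dE muln_gt0 => /andP[].
have n_gt1 : (1 < p ^ k)%N.
  by rewrite -(exp1n k) ltn_exp2r ?prime_gt1.
exists g, m, c; split=> //.
  apply: (locgen_extension p_pr) => //.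
    by move=> q Pq; apply: (loc_multiples_lift tauE) => //; apply: tauP.
  right; have [M /andP[M_gt0 copM] hM] := residue_exponent nf hP p_pr Pp.
  have nPc : ~ P c.
    move=> Pc; apply: nPt; have -> : t = t - c ^+ (p ^ k) + c ^+ (p ^ k) by ring.
    by apply: (primeD hP) => //; apply: (primeX hP) => //; apply: ltnW.
  exists (m * M)%N; first by rewrite muln_gt0 m_gt0 M_gt0 coprimeMr copm copM.
  have -> : alpha ^+ (m * M) - 1 = (alpha ^+ (m * M) - c ^+ M) + (c ^+ M - 1) by ring.
  apply: (loc_multiplesD hQ).
    rewrite exprM subrXX mulrC; apply: loc_multiplesM; last exact: loc_multiples_self.
    by rewrite rpred_sum // => i _; rewrite rpredM ?rpredX // ?RS.
  by apply: (loc_multiples_lift tauE) => //; apply: tauP; apply: hM.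
split=> // q Pq; apply: (sq_lift tauE) => //; last exact: tauP.
apply: (primeD hQ); first by apply: (primeX hQ) => //; rewrite -ltnS prednK // ltnW.
by apply: (primeMr hQ) => //; case: Pp.
Qed.

Lemma unramified_case : ~ P t -> ~ P d%:R ->
  exists2 g, P g & P `<=` loc_multiples R P g /\ Q `<=` loc_multiples S Q g.
Proof.
move=> nPt nPd; have [p p_pr Pp] := prime_has_char Rint hP.
have [g Pg gP] := lpP; exists g => //; split=> //.
have gP' : P `<=` loc_multiples S Q g.
  by move=> q Pq; apply: (@loc_multiples_lift g 1 g); rewrite ?mulr1 ?rpred1 //; apply: gP.
apply: (locgen_extension p_pr) => //; first by case: Pg.
right; have [M /andP[M_gt0 copM] hM] := residue_exponent nf hP p_pr Pp.
exists (d * M)%N.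
  rewrite muln_gt0 M_gt0 andbT (ltnW d_gt1) coprimeMr copM andbT /= prime_coprime //.
  by apply/negP => /(prime_natP hP p_pr Pp).
by rewrite exprM alphaX; apply: gP'; apply: hM.
Qed.

Lemma locally_principal_extension : locally_principal S Q.
Proof.
have [Pt|nPt] := pselect (P t).
  by have [g [m [c [_ _ Qg gQ _]]]] := ramified_case (or_introl Pt); exists g.
have [Pd|nPd] := pselect (P d%:R).
  by have [g [m [c [_ _ Qg gQ _]]]] := ramified_case (or_intror Pd); exists g.
by have [g [_ Qg] [_ gQ]] := unramified_case nPt nPd; exists g.
Qed.

(** By the Eisenstein equation, the [p ^ k]-th power of [alpha ^+ m - c] equals a
    local generator of [P] up to local units. *)
Lemma power_shift_independent p k m : prime p -> P p%:R -> d = (p ^ k * m)%N -> (0 < k)%N ->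
  exists2 c, c \in R & forall r : nat -> Om, (forall i, r i \in R) ->
    \sum_(i < p ^ k) r i * (alpha ^+ m - c) ^+ i = 0 ->
    forall i, (i < p ^ k)%N -> r i = 0.
Proof.
move=> p_pr Pp dE k_gt0.
have [c cR [w wS [Qg Ptau ntau tauE]]] := eisenstein_shift p_pr Pp dE k_gt0.
set g := alpha ^+ m - c in Qg tauE *; set tau := t - _ in Ptau ntau tauE.
have tauP := locgen_of_notin_sq nf Rint hP lpP Ptau ntau.
exists c => //; have [_ [s [sR ns] [r rR E]]] := tauP _ Pp.
have tau0 := locgen_neq0 hP tauP.
have g0 : g != 0 by apply: contraNneq tau0 => g0; rewrite tauE g0 mul0r.
have n_gt0 : (0 < p ^ k)%N by rewrite expn_gt0 prime_gt0.
(* [tau * (s - r g w) = s * g ^+ (p ^ k)], where [s * p = tau * r]. *)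
have Qs : ~ Q (s - r * g * w).
  move=> Qs; apply: (contraction_not sR ns).
  have -> : s = s - r * g * w + g * (r * w) by ring.
  apply: (primeD hQ) => //; apply: (primeMr hQ) => //.
  by rewrite rpredM // ?RS.
have gS := prime_sub hQ Qg.
apply: (@powers_independent g tau s (s - r * g * w) (p ^ k)) => //.
- exact: RS.
- by rewrite rpredB ?rpredM // ?RS.
have -> : (s - r * g * w) * tau = s * tau - (tau * r) * g * w by ring.
by rewrite -E {1}tauE -[in RHS](prednK n_gt0) exprS; ring.
Qed.

End Extension.

(** * The tower of preimages *)

Definition adjoin_pred (Om : fieldType) (R : {pred Om}) (alpha : Om) : {pred Om} :=
  fun x => `[< exists2 q, q \is a polyOver R & x = q.[alpha] >].

Section Adjoin.
Variables (Om : fieldType) (R : subringClosed Om) (alpha : Om).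

Lemma adjoinP x : reflect (exists2 q, q \is a polyOver R & x = q.[alpha])
  (x \in adjoin_pred R alpha).
Proof. exact: asboolP. Qed.

Lemma adjoin_subring : subring_closed (adjoin_pred R alpha).
Proof.
split; first by apply/adjoinP; exists 1; rewrite ?rpred1 // hornerC.
- move=> x y /adjoinP[q qR ->] /adjoinP[q' q'R ->]; apply/adjoinP.
  by exists (q - q'); rewrite ?rpredB // !hornerE.
- move=> x y /adjoinP[q qR ->] /adjoinP[q' q'R ->]; apply/adjoinP.
  by exists (q * q'); rewrite ?rpredM // !hornerE.
Qed.

HB.instance Definition _ :=
  GRing.isSubringClosed.Build Om (adjoin_pred R alpha) adjoin_subring.

Lemma mem_adjoin : alpha \in adjoin_pred R alpha.
Proof. by apply/adjoinP; exists 'X; rewrite ?polyOverX // hornerX. Qed.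

Lemma sub_adjoin : {subset R <= adjoin_pred R alpha}.
Proof. by move=> x xR; apply/adjoinP; exists x%:P; rewrite ?polyOverC // hornerC. Qed.

Lemma adjoin_sub (S : subringClosed Om) : {subset R <= S} -> alpha \in S ->
  {subset adjoin_pred R alpha <= S}.
Proof.
move=> RS aS x /adjoinP[q qR ->].
by apply: rpred_horner => //; apply: polyOverS qR.
Qed.

End Adjoin.

Section Dynamics.
Variables (Om : fieldType) (nf : number_field Om) (R0 : subringClosed Om).
Variables (R0int : {subset R0 <= @algint Om}) (d : nat) (d_gt1 : (1 < d)%N).
Variables (u v b : Om) (uR0 : u \in R0) (vR0 : v \in R0) (bR0 : b \in R0) (vu : v * u = 1).

Let phi (x : Om) : Om := u * x ^+ d + b.

(** The invariant of the tower: the two conditions of the theorem, relative to the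
    order [R] and to the value [a] whose preimage is adjoined next, together with the
    regularity of [R]. *)
Record tower_ready (R : {pred Om}) (a : Om) : Prop := TowerReady {
  ready_locally_principal : forall P, nonzero_prime R P -> locally_principal R P;
  ready_orbit : forall P, nonzero_prime R P -> ~ P d%:R ->
    forall j, ~ ideal_sq P (iter j.+1 phi 0 - a);
  ready_wild : forall P, nonzero_prime R P -> forall p, prime p -> P p%:R -> (p %| d)%N ->
    forall c, c \in R -> ~ ideal_sq P (v * (a - b) - c ^+ p)
}.

Section Step.
Variables (R S : subringClosed Om) (R0R : {subset R0 <= R}) (RS : {subset R <= S}).
Variables (Sint : {subset S <= @algint Om}) (alpha : Om).
Hypotheses (aS : alpha \in S) (paR : phi alpha \in R).
Hypothesis S_gen : forall x, x \in S -> exists2 q, q \is a polyOver R & x = q.[alpha].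
Hypothesis gR : tower_ready R (phi alpha).

Let t := v * (phi alpha - b).

Let tR : t \in R.
Proof. by rewrite rpredM ?rpredB // ?R0R //. Qed.

Let alphaX : alpha ^+ d = t.
Proof. by rewrite /t /phi addrK mulrA vu mul1r. Qed.

Let Rint : {subset R <= @algint Om}.
Proof. by move=> x /RS/Sint. Qed.

Section AtPrime.
Variables (Q : set Om) (hQ : nonzero_prime S Q).
Let P : set Om := [set x | x \in R /\ Q x].
Let hP : nonzero_prime R P := prime_contraction nf RS Sint hQ.

Let lpP : locally_principal R P := ready_locally_principal gR hP.

Let tame : ~ P d%:R -> ~ ideal_sq P t.
Proof.
move=> nPd sqt; apply: (ready_orbit gR hP nPd (j := 0%N)); rewrite /=.
have -> : phi 0 - phi alpha = (- u) * t.
  by rewrite /phi -alphaX expr0n gtn_eqF 1?ltnW // mulr0; ring.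
by apply: (sqM hP) => //; rewrite rpredN R0R.
Qed.

Let wild p : prime p -> P p%:R -> (p %| d)%N ->
  forall c, c \in R -> ~ ideal_sq P (t - c ^+ p).
Proof. exact: (ready_wild gR hP). Qed.

Lemma step_locally_principal : locally_principal S Q.
Proof.
exact: (locally_principal_extension nf RS Sint hQ aS tR d_gt1 alphaX S_gen lpP tame wild).
Qed.

Lemma orbit_in_R j : iter j phi 0 \in R.
Proof.
elim: j => [|j IH] /=; first exact: rpred0.
by rewrite /phi rpredD ?rpredM ?rpredX // ?R0R //.
Qed.

(** When [t] is in [P], membership of [y - alpha] in the square of [Q] would put [y]
    in [P], hence in that square, hence also [alpha], which generates [Q] locally.
    Otherwise [Q] is unramified over [P], and [phi y - phi alpha] gives an element
    of the square of [P], which the orbit condition for [R] excludes one iterate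
    later. *)
Lemma step_orbit : ~ Q d%:R -> forall j, ~ ideal_sq Q (iter j.+1 phi 0 - alpha).
Proof.
move=> nQd j; set y := iter j.+1 phi 0 => sqy.
have yR : y \in R by apply: orbit_in_R.
have nPd : ~ P d%:R by case.
have Qya := sq_sub hQ sqy.
have [Pt|nPt] := pselect (P t).
  have [g [m [c [gE cR Qg gQ [Psq /(_ Pt) ga]]]]] :=
    ramified_case nf RS Sint hQ aS tR d_gt1 alphaX S_gen lpP tame wild (or_introl Pt).
  rewrite {}ga {gE g} in Qg gQ.
  have Py : P y.
    by split; rewrite // -(subrK alpha y); apply: (primeD hQ).
  apply: (locgen_notin_sq hQ Qg gQ).
  have -> : alpha = y - (y - alpha) by ring.
  by apply: (sqB hQ) => //; apply: Psq.
have [g Pg [gP gQ]] := unramified_case nf RS Sint hQ aS tR d_gt1 alphaX S_gen lpP nPt nPd.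
have Qg : Q g by case: Pg.
set z := phi y - phi alpha.
have zR : z \in R by rewrite rpredB // /phi rpredD ?rpredM ?rpredX // ?R0R //.
have sqz : ideal_sq Q z.
  have -> : z = u * (\sum_(i < d) y ^+ (d.-1 - i) * alpha ^+ i) * (y - alpha).
    by rewrite -mulrA [X in u * X]mulrC -subrXX /z /phi; ring.
  apply: (sqM hQ) => //; apply: rpredM; first exact/RS/R0R.
  by apply: rpred_sum => i _; apply: rpredM; apply: rpredX => //; apply: RS.
have Pz : P z by split=> //; apply: (sq_sub hQ sqz).
have [_ [s [sR ns] [r rR E]]] := gP z Pz.
have Pr : P r.
  split=> //; apply: contrapT => nQr.
  apply: (locgen_notin_sq hQ Qg gQ); apply: (sq_cancel nf Sint hQ (RS rR)) => //.
  by rewrite mulrC -E; apply: (sqM hQ) => //; apply: RS.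
apply: (ready_orbit gR hP nPd (j := j.+1)).
rewrite -/(phi _) [iter _ _ _]/= -/(iter j.+1 phi 0) -/y -/z.
by apply: (sq_cancel nf Rint hP sR ns Pz); rewrite E; apply: sq_mul.
Qed.

(** Since [p] is in the square of [Q], the [p]-th powers modulo that square form a ring
    [W]; it contains [R] because residue fields are perfect and [P] is in the square
    of [Q].  If [v * (alpha - b)] were in [W], so would be [alpha] and the local
    generator [g]; but a [p]-th power in [Q] is in the square of [Q]. *)
Lemma step_wild p : prime p -> Q p%:R -> (p %| d)%N ->
  forall c, c \in S -> ~ ideal_sq Q (v * (alpha - b) - c ^+ p).
Proof.
move=> p_pr Qp pd e eS sqe.
have Pp : P p%:R by split; rewrite ?rpred_nat.
have Pd : P d%:R by apply/(prime_natP hP p_pr Pp).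
have [g [m [c [gE cR Qg gQ [Psq _]]]]] :=
    ramified_case nf RS Sint hQ aS tR d_gt1 alphaX S_gen lpP tame wild (or_intror Pd).
pose W x := x \in S /\ exists2 e, e \in S & ideal_sq Q (x - e ^+ p).
have WD x y : W x -> W y -> W (x + y).
  move=> [xS [f fS Wx]] [yS [h hS Wy]]; split; first exact: rpredD.
  exists (f + h); first exact: rpredD.
  have [w wS ->] := frobenius1 p_pr fS hS.
  have -> : x + y - (f ^+ p + h ^+ p + p%:R * (f * w)) =
    (x - f ^+ p) + (y - h ^+ p) - (f * w) * p%:R by ring.
  by apply: (sqB hQ); [apply: sqD | apply: (sqM hQ); [rewrite rpredM | apply: Psq]].
have WM x y : W x -> W y -> W (x * y).
  move=> [xS [f fS Wx]] [yS [h hS Wy]]; split; first exact: rpredM.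
  exists (f * h); first exact: rpredM.
  have -> : x * y - (f * h) ^+ p = x * (y - h ^+ p) + h ^+ p * (x - f ^+ p).
    by rewrite exprMn; ring.
  by apply: sqD; apply: (sqM hQ); rewrite ?rpredX.
have WR x : x \in R -> W x.
  move=> xR; split; first exact: RS.
  have [f fR Pf] := residue_root nf hP 1 p_pr Pp xR.
  by exists f; [apply: RS | apply: Psq; move: Pf; rewrite expn1].
have Wa : W alpha.
  have -> : alpha = u * (v * (alpha - b)) + b.
    by rewrite mulrA (mulrC u) vu mul1r subrK.
  apply: (WD) (WR _ (R0R bR0)); apply: (WM) (WR _ (R0R uR0)) _.
  by split; [apply: rpredM; [exact/RS/R0R | rewrite rpredB //; exact/RS/R0R] | exists e].
have WX k : W (alpha ^+ k).
  elim: k => [|k IH]; first by rewrite expr0; apply: WR; rewrite rpred1.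
  by rewrite exprS; apply: WM.
have [_ [f fS Wg]] : W g.
  by rewrite gE; apply: (WD) (WX m) (WR _ _); rewrite rpredN.
apply: (locgen_notin_sq hQ Qg gQ).
have Qf : Q (f ^+ p).
  by rewrite -(subKr g (f ^+ p)); apply: (primeB hQ Qg); apply: (sq_sub hQ Wg).
rewrite -(subrK (f ^+ p) g); apply: sqD => //.
by apply: (sqX hQ); [apply: (prime_root hQ fS Qf) | apply: prime_gt1].
Qed.

Lemma step_independent p k m : prime p -> Q p%:R -> d = (p ^ k * m)%N -> (0 < k)%N ->
  exists2 c, c \in R & forall r : nat -> Om, (forall i, r i \in R) ->
    \sum_(i < p ^ k) r i * (alpha ^+ m - c) ^+ i = 0 ->
    forall i, (i < p ^ k)%N -> r i = 0.
Proof.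
move=> p_pr Qp dE k_gt0; have Pp : P p%:R by split; rewrite ?rpred_nat.
exact (power_shift_independent nf RS Sint hQ aS tR alphaX lpP wild p_pr Pp dE k_gt0).
Qed.

End AtPrime.

Lemma tower_ready_extension : tower_ready S alpha.
Proof.
split; [exact: step_locally_principal | exact: step_orbit |].
by move=> Q hQ p; apply: step_wild.
Qed.

Lemma tower_ready_independent p k m : prime p -> d = (p ^ k * m)%N -> (0 < k)%N ->
  exists2 c, c \in R & forall r : nat -> Om, (forall i, r i \in R) ->
    \sum_(i < p ^ k) r i * (alpha ^+ m - c) ^+ i = 0 ->
    forall i, (i < p ^ k)%N -> r i = 0.
Proof.
move=> p_pr; have [Q hQ Qp] := prime_over nf Sint p_pr.
exact: step_independent hQ p k m p_pr Qp.
Qed.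

End Step.

Lemma algint_preimage (alpha : Om) : phi alpha \in @algint Om -> alpha \in @algint Om.
Proof.
move=> pa; have tint : v * (phi alpha - b) \in @algint Om.
  by rewrite rpredM ?rpredB // R0int.
apply/algintP; apply: (@integral_root_monic _ _ _ alpha ('X^d - (v * (phi alpha - b))%:P)).
- by rewrite monicXnsubC // ltnW.
- by rewrite rootE !(hornerD, hornerN, hornerXn, hornerC) /phi addrK mulrA vu mul1r subrr.
apply/integral_poly => k.
have : ('X^d - (v * (phi alpha - b))%:P) \is a polyOver (@algint Om).
  by rewrite rpredB ?rpredX ?polyOverX // polyOverC.
by move/polyOverP/(_ k)/algintP.
Qed.

Lemma tower_ready_iterates a : a \in R0 -> tower_ready R0 a ->
  forall n alpha, iter n phi alpha = a ->
    {subset adjoin_pred R0 alpha <= @algint Om} /\ tower_ready (adjoin_pred R0 alpha) alpha.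
Proof.
move=> aR0 ready0; elim=> [|n IH] alpha.
  move=> /= ->.
  have -> : adjoin_pred R0 a = (R0 : {pred Om}) :> {pred Om}.
    apply: funext => x; apply/idP/idP; last exact: sub_adjoin.
    exact: (@adjoin_sub _ R0 a R0).
  by [].
rewrite iterSr => /IH[Rint gR].
have aint : alpha \in @algint Om by apply/algint_preimage/Rint/mem_adjoin.
have Sint : {subset adjoin_pred R0 alpha <= @algint Om} by apply: adjoin_sub.
split=> //; apply: (tower_ready_extension _ _ Sint _ _ _ gR).
- exact: sub_adjoin.
- apply: adjoin_sub; first exact: sub_adjoin.
  rewrite /phi rpredD ?rpredM ?rpredX ?mem_adjoin //; exact: sub_adjoin.
- exact: mem_adjoin.
- exact: mem_adjoin.
move=> x /adjoinP[q qR ->]; exists q => //.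
by apply: polyOverS qR; apply: sub_adjoin.
Qed.

End Dynamics.

(** * Number fields *)

Section NumberFields.

Lemma rat_common_denominator n (k : nat -> rat) : exists2 D : int, D != 0 &
  forall i, (i < n)%N -> exists z : int, k i * D%:~R = z%:~R.
Proof.
elim: n => [|n [D D0 hD]]; first by exists 1.
exists (D * denq (k n)); first by rewrite mulf_neq0 ?denq_neq0.
move=> i; rewrite ltnS leq_eqVlt => /predU1P[->|/hD[z zE]].
  exists (D * numq (k n)); rewrite !rmorphM /= mulrCA; congr (_ * _).
  by rewrite numqE.
by exists (z * denq (k n)); rewrite !rmorphM /= mulrA zE.
Qed.

Lemma number_field_rat (E : fieldExtType rat) : number_field E.
Proof.
split=> [n|].
  by rewrite -[n%:R]scaler_nat scaler_eq0 oner_eq0 orbF pnatr_eq0.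
exists (\dim {:E}).+1; set n := (\dim {:E}).+1 => v.
have [k [sum0 [i0 ki0]]] : exists k : 'I_n -> rat,
    \sum_(i < n) k i *: v i = 0 /\ exists i, k i != 0.
  pose X := [tuple v i | i < n].
  have nfree : ~~ free X.
    apply/negP => /eqP; rewrite size_tuple => fr.
    by have := dimvS (subvf <<X>>); rewrite fr ltnn.
  apply: contrapT => nex; case/negP: nfree; apply/freeP => k sumk i.
  apply/eqP; apply: contrapT => /negP ki; apply: nex; exists k; split; last by exists i.
  by rewrite -[RHS]sumk; apply: eq_bigr => j _; rewrite -tnth_nth tnth_mktuple.
pose k' i := k (inord i).
have [D D0 hD] := rat_common_denominator n k'.
have /boolp.choice[c hc] : forall i, exists z : int, (i < n)%N -> k' i * D%:~R = z%:~R.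
  move=> i; have [/hD[z zE]|] := boolP (i < n)%N; first by exists z.
  by exists 0.
have D0' : D%:~R != 0 :> rat by rewrite intr_eq0.
exists c.
  exists i0 => //; apply: contraNneq ki0 => c0.
  have := hc i0 (ltn_ord i0); rewrite c0 /k' inord_val => /eqP.
  by rewrite mulf_eq0 (negPf D0') orbF.
have -> : \sum_(i < n) (c i)%:~R * v i = D%:~R *: \sum_(i < n) k i *: v i.
  rewrite scaler_sumr; apply: eq_bigr => i _.
  have hci : k i * D%:~R = (c i)%:~R by have := hc i (ltn_ord i); rewrite /k' inord_val.
  by rewrite scalerA mulrC [X in X *: _]mulrC hci scaler_int mulrzr.
by rewrite sum0 scaler0.
Qed.

(** The extension is viewed over the rationals; its field structure is unchanged. *)
Lemma number_field_ext (K : fieldExtType rat) (L : fieldExtType K) : number_field L.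
Proof. exact: number_field_rat (baseFieldType L). Qed.

(** For a relation with leading coefficient [c], the element [c x] is integral. *)
Lemma algint_clear_denominator (Om : fieldType) : number_field Om ->
  forall x : Om, exists2 N, (0 < N)%N & N%:R * x \in @algint Om.
Proof.
move=> [ch [n hn]] x.
have [c [i0 lti0 ci0] sum0] := hn (fun i => x ^+ i).
pose Q (m : nat) := (m < n)%N && (c m != 0).
have exQ : exists m, Q m by exists i0; rewrite /Q lti0.
have ubQ m : Q m -> (m <= n)%N by case/andP=> /ltnW.
case: (ex_maxnP exQ ubQ) => m /andP[ltmn cm0] maxm.
have intN (N : int) : N != 0 -> N%:~R * x \in @algint Om ->
    exists2 N, (0 < N)%N & N%:R * x \in @algint Om.
  move=> N0 Nx; exists `|N|%N; first by rewrite absz_gt0.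
  have [N_ge0|N_lt0] := lerP 0 N.
    by rewrite -[_%:R]/((Posz `|N|)%:~R) gez0_abs.
  rewrite -[_%:R]/((Posz `|N|)%:~R) ltz0_abs // rmorphN mulNr.
  by rewrite rpredN.
apply: (intN (c m)) => //; set C := (c m)%:~R.
have rel : C * x ^+ m = - \sum_(i < m) (c i)%:~R * x ^+ i.
  apply/eqP; rewrite -addr_eq0 addrC; apply/eqP.
  rewrite -[RHS]sum0 -(big_mkord predT (fun i => (c i)%:~R * x ^+ i)) /=.
  rewrite -[RHS](big_mkord predT (fun i => (c i)%:~R * x ^+ i)) /=.
  rewrite (big_cat_nat (leq0n m.+1) ltmn) /= big_nat_recr //= [X in _ = _ + X]big1_seq ?addr0 //.
  move=> i /andP[_]; rewrite mem_index_iota => /andP[ltmi ltin].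
  have [->|ci] := eqVneq (c i) 0; first by rewrite mul0r.
  by have := maxm i; rewrite /Q ltin ci leqNgt ltmi => /(_ isT).
case: m => [|m] in ltmn cm0 maxm C rel *.
  have : C = 0 by move: rel; rewrite big_ord0 oppr0 expr0 mulr1.
  rewrite /C => C0; rewrite -/C /C C0 mul0r; exact: rpred0.
(* The relation multiplied by [C ^+ m], read as an equation of [C * x]. *)
pose q : {poly Om} := 'X^(m.+1) + \poly_(i < m.+1) ((c i)%:~R * C ^+ (m - i)).
apply/algintP; apply: (@integral_root_monic _ _ _ _ q).
- apply/monicP; rewrite lead_coefDl ?lead_coefXn // size_polyXn ltnS.
  exact: size_poly.
- rewrite rootE hornerD hornerXn horner_poly exprMn exprSr -mulrA rel mulrN mulr_sumr.
  rewrite addrC subr_eq0; apply/eqP; apply: eq_bigr => i _.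
  have -> : C ^+ m = C ^+ i * C ^+ (m - i) by rewrite -exprD subnKC // -ltnS.
  by rewrite exprMn; ring.
apply/integral_poly => k.
have : q \is a polyOver (@algint Om).
  rewrite rpredD ?rpredX ?polyOverX //; apply/polyOver_poly => i _.
  by rewrite rpredM ?rpredX ?rpred_int.
by move/polyOverP/(_ k)/algintP.
Qed.

Lemma common_denominator_seq (Om : fieldType) (R : subringClosed Om) n (x : nat -> Om) :
  (forall i, (i < n)%N -> exists2 N, (0 < N)%N & N%:R * x i \in R) ->
  exists2 N, (0 < N)%N & forall i, (i < n)%N -> N%:R * x i \in R.
Proof.
elim: n => [|n IH] hx; first by exists 1%N.
have [|N N0 hN] := IH; first by move=> i lti; apply: hx; apply: ltnW.
have [M M0 hM] := hx n (ltnSn n).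
exists (M * N)%N => [|i]; first by rewrite muln_gt0 M0.
rewrite ltnS leq_eqVlt => /predU1P[->|/hN h].
  by rewrite mulnC natrM -mulrA rpredM ?rpred_nat.
by rewrite natrM -mulrA rpredM ?rpred_nat.
Qed.

Lemma algint_root_unit (Om : fieldType) (g : {poly Om}) (al : Om) :
  g \is a polyOver (@algint Om) -> (lead_coef g)^-1 \in @algint Om -> g != 0 ->
  root g al -> al \in @algint Om.
Proof.
move=> /polyOverP gO lO g0 rt; apply/algintP.
apply: (@integral_root_monic _ _ _ _ ((lead_coef g)^-1 *: g)).
- by apply/monicP; rewrite lead_coefZ mulVf ?lead_coef_eq0.
- by rewrite rootZ // invr_eq0 lead_coef_eq0.
by apply/integral_poly => k; rewrite coefZ; apply/algintP/rpredM.
Qed.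

Lemma algint_quadratic (Om : fieldType) (A B y : Om) :
  A \in @algint Om -> B \in @algint Om -> y ^+ 2 = A + B * y -> y \in @algint Om.
Proof.
move=> AO BO yE; apply/algintP.
apply: (@integral_root_monic _ _ _ _ ('X^2 + (- (B *: 'X) - A%:P))).
- apply/monicP; rewrite lead_coefDl ?lead_coefXn // size_polyXn ltnS.
  rewrite (leq_trans (size_polyD _ _)) // geq_max !size_polyN.
  rewrite (leq_trans (size_scale_leq _ _)) ?size_polyX //=.
  by rewrite (leq_trans (size_polyC_leq1 _)).
- rewrite rootE !(hornerD, hornerN, hornerXn, hornerC, hornerZ, hornerX) yE.
  by apply/eqP; ring.
apply/integral_poly => k.
have : ('X^2 + (- (B *: 'X) - A%:P)) \is a polyOver (@algint Om).
  by rewrite rpredD ?rpredX ?polyOverX // rpredB ?rpredN ?polyOverC // polyOverZ ?polyOverX.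
by move/polyOverP/(_ k)/algintP.
Qed.

End NumberFields.

Section IdealPowers.
Variables (R : comNzRingType) (I : prime_idealr R).

Lemma ideal_exp2_in x : ideal_exp [set` I] 2 x -> exists2 s : seq (R * R),
  (forall z, z \in s -> z.1 \in I /\ z.2 \in I) & x = \sum_(z <- s) z.1 * z.2.
Proof.
case=> s hs ->; exists s => // z /hs[/= z1 [s' hs' ->]]; split=> //.
rewrite big_seq rpred_sum // => w /hs'[/= w1 _].
by rewrite mulrC; apply: idealMr.
Qed.

Lemma ideal_exp2_cons x y z : x \in I -> y \in I -> ideal_exp [set` I] 2 z ->
  ideal_exp [set` I] 2 (x * y + z).
Proof.
move=> xI yI [s hs ->]; exists ((x, y) :: s); last by rewrite big_cons.
move=> w; rewrite in_cons => /predU1P[->|/hs//]; split=> //=.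
exists [:: (y, 1)]; last by rewrite big_seq1 mulr1.
by move=> v; rewrite inE => /eqP->.
Qed.

Lemma ideal_exp2_0 : ideal_exp [set` I] 2 0.
Proof. by exists [::] => //; rewrite big_nil. Qed.

Lemma adic_val_le1 x : (adic_val I x <= 1%:E)%E <-> ~ ideal_exp [set` I] 2 x.
Proof.
rewrite /adic_val; case: pselect => [h|nex]; last first.
  split=> //= ne; case: nex; exists 1%N.
  by rewrite notin_setE.
case: ex_minnP => m; rewrite notin_setE => hm minm; rewrite lee_fin lez_nat.
split=> [lem1 ideal_sq|nsq]; last by apply: minm; rewrite notin_setE.
have {lem1} : m = 0%N \/ m = 1%N by case: m lem1 {hm minm} => [|[|]] //; [left | right].
case=> m1; rewrite m1 in hm; last by [].
have [s hs xE] := ideal_exp2_in ideal_sq.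
apply: hm; exists s => //; by move=> z /hs[z1 _].
Qed.

Lemma residue_charP p : residue_char I p <-> prime p /\ p%:R \in I.
Proof.
rewrite /residue_char inE /=.
have -> : (p%:R == 0 :> {ideal_quot I}) = (p%:R \in I).
  rewrite -[p%:R \in I]/(p%:R \in (I : pred R)) -[p%:R in RHS]subr0 Quotient.idealrBE.
  by rewrite rmorph_nat rmorph0.
by split=> [/andP[]|[-> ->]].
Qed.

End IdealPowers.

Lemma prime_idealr_of (R : comNzRingType) (S : {pred R}) :
  idealr_closed S -> prime_idealr_closed S -> exists I : prime_idealr R, I =i S.
Proof.
move=> Sid Spr.
pose m1 := isIdealr.Build R S Sid.
pose m2 := isPrimeIdealrClosed.Build R S Spr.
pose I : prime_idealr R := HB.pack S m1 m2.
by exists I.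
Qed.

(** * Transfer between a number field and its extensions *)

Section Embedding.
Variables (K : fieldExtType rat) (L : fieldExtType K).
Local Notation O := (ring_of_integers K).
Local Notation emb := (@oalg K L).

Lemma oalg_zmod_morphism : zmod_morphism emb.
Proof. by move=> x y; rewrite /oalg rmorphB /= scalerBl. Qed.

Lemma oalg_monoid_morphism : monoid_morphism emb.
Proof.
by split=> [|x y]; rewrite /oalg ?rmorph1 ?scale1r // rmorphM /= -scalerAl mul1r scalerA.
Qed.

HB.instance Definition _ := GRing.isZmodMorphism.Build O L emb oalg_zmod_morphism.
HB.instance Definition _ := GRing.isMonoidMorphism.Build O L emb oalg_monoid_morphism.

Lemma oalg_inj : injective emb.
Proof.
move=> x y /eqP; rewrite /oalg -subr_eq0 -scalerBl scaler_eq0 oner_eq0 orbF subr_eq0.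
by move/eqP/val_inj.
Qed.

Lemma algint_scalar (k : K) : (k%:A \in @algint L) = (k \in @algint K).
Proof.
have rtE (q : {poly int}) :
    root (map_poly (intr : int -> L) q) k%:A = root (map_poly (intr : int -> K) q) k.
  have -> : map_poly (intr : int -> L) q =
      map_poly (in_alg L) (map_poly (intr : int -> K) q).
    rewrite -map_poly_comp; apply: eq_map_poly => z /=.
    by rewrite -[z%:~R%:A]/(in_alg L z%:~R) rmorph_int.
  by rewrite -[k%:A]/(in_alg L k) fmorph_root.
apply/idP/idP => /algintP[q qmon qk]; apply/algintP; exists q => //.
  by rewrite -rtE.
by rewrite rtE.
Qed.

Definition Oimage : {pred L} := fun x => `[< exists c : O, x = emb c >].

Lemma OimageP x : reflect (exists c : O, x = emb c) (x \in Oimage).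
Proof. exact: asboolP. Qed.

Lemma Oimage_subring : subring_closed Oimage.
Proof.
split; first by apply/OimageP; exists 1; rewrite rmorph1.
- by move=> _ _ /OimageP[x ->] /OimageP[y ->]; apply/OimageP; exists (x - y); rewrite rmorphB.
- by move=> _ _ /OimageP[x ->] /OimageP[y ->]; apply/OimageP; exists (x * y); rewrite rmorphM.
Qed.

HB.instance Definition _ := GRing.isSubringClosed.Build L Oimage Oimage_subring.

Lemma mem_Oimage c : emb c \in Oimage.
Proof. by apply/OimageP; exists c. Qed.

Lemma Oimage_algint : {subset Oimage <= @algint L}.
Proof. by move=> _ /OimageP[c ->]; rewrite algint_scalar; apply: ovalP. Qed.

Lemma scalar_Oimage k : k%:A \in @algint L -> k%:A \in Oimage.
Proof. by rewrite algint_scalar => kO; apply/OimageP; exists (RingOfIntegers kO). Qed.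

Lemma Oimage_locally_principal P : nonzero_prime Oimage P -> locally_principal Oimage P.
Proof.
move=> hP; have nf := number_field_ext L.
apply: (locally_principal_of_integrally_closed nf Oimage_algint) => // y N yint N_gt0.
move=> /OimageP[c cE].
have N0 : N%:R != 0 :> K by rewrite (number_field_rat K).1 -lt0n.
have yE : y = (val c / N%:R)%:A.
  have N0' : N%:R != 0 :> L by rewrite nf.1 -lt0n.
  apply: (mulfI N0'); rewrite cE /oalg -[N%:R in RHS](rmorph_nat (in_alg L)) -rmorphM /=.
  by rewrite mulrC divfK.
by rewrite yE in yint *; apply: scalar_Oimage.
Qed.

Lemma map_oalg_poly (q : {poly L}) : q \is a polyOver Oimage ->
  exists q' : {poly O}, q = map_poly emb q'.
Proof.
move=> /polyOverP qO.
have /boolp.choice[c hc] : forall i, exists c : O, q`_i = emb c.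
  by move=> i; apply/OimageP/qO.
exists (\poly_(i < size q) c i); apply/polyP => i.
rewrite coef_map coef_poly; case: ltnP => [_|le]; first by rewrite hc.
by rewrite raddf0 nth_default.
Qed.

Lemma adjoin_OimageP (al : L) x :
  reflect (exists q : {poly O}, x = (map_poly emb q).[al]) (x \in adjoin_pred Oimage al).
Proof.
apply: (iffP (adjoinP _ _ _)) => [[q /map_oalg_poly[q' ->] ->]|[q ->]]; first by exists q'.
exists (map_poly emb q) => //.
by apply/polyOverP => i; rewrite coef_map mem_Oimage.
Qed.

Section Transfer.
Variables (P : set L) (hP : nonzero_prime Oimage P).

Lemma prime_preimage : exists I : prime_idealr O, forall c, c \in I <-> P (emb c).
Proof.
pose S : {pred O} := fun c => `[< P (emb c) >].
have [||I IS] := @prime_idealr_of _ S.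
- split.
  + by apply/asboolP; rewrite rmorph0; apply: (prime0 hP).
  + by apply/asboolPn; rewrite rmorph1; apply: (prime_not1 hP).
  + move=> a x y /asboolP Px /asboolP Py; apply/asboolP; rewrite rmorphD rmorphM.
    by apply: (primeD hP) => //; apply: (primeMl hP); rewrite ?mem_Oimage.
- move=> x y /asboolP; rewrite rmorphM => /(primeM hP); rewrite !mem_Oimage => -[]// Pz.
    by apply/orP; left; apply/asboolP.
  by apply/orP; right; apply/asboolP.
by exists I => c; rewrite IS; split=> /asboolP.
Qed.

Variables (I : prime_idealr O) (IE : forall c, c \in I <-> P (emb c)).

Lemma preimage_nonzero : nonzero_ideal I.
Proof.
have [x Px x0] := prime_nz hP; have /OimageP[c cE] := prime_sub hP Px.
exists c; first by apply/IE; rewrite -cE.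
by apply: contraNneq x0 => c0; rewrite cE c0 rmorph0.
Qed.

Lemma sq_preimage c : ideal_sq P (emb c) -> ideal_exp [set` I] 2 c.
Proof.
suff: forall x, ideal_sq P x -> exists2 c, x = emb c & ideal_exp [set` I] 2 c.
  by move=> /[apply] -[c' /oalg_inj ->].
move=> x; elim=> [|{}x y z Px Py _ [e -> Ie]].
  by exists 0; [rewrite rmorph0 | apply: ideal_exp2_0].
have /OimageP[cx cxE] := prime_sub hP Px; have /OimageP[cy cyE] := prime_sub hP Py.
exists (cx * cy + e); first by rewrite rmorphD rmorphM cxE cyE.
by apply: ideal_exp2_cons => //; apply/IE; rewrite -?cxE -?cyE.
Qed.

End Transfer.

End Embedding.

Section Iterates.
Variables (R : comNzRingType) (f : {poly R}).

Lemma poly_iterS n : poly_iter f n.+1 = f \Po poly_iter f n.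
Proof. by []. Qed.

Lemma horner_poly_iter (A : comNzRingType) (h : {rmorphism R -> A}) n x :
  (map_poly h (poly_iter f n)).[x] = iter n (fun y => (map_poly h f).[y]) x.
Proof.
elim: n => [|n IH]; first by rewrite map_polyX hornerX.
by rewrite poly_iterS map_comp_poly horner_comp IH.
Qed.

End Iterates.

(** * Degrees and rings of integers in the tower *)

Section Sufficiency.
Variables (K : fieldExtType rat) (d : nat) (d_gt1 : (1 < d)%N).
Variables (a u b : ring_of_integers K) (hu : u \is a GRing.unit).
Local Notation O := (ring_of_integers K).
Let f : {poly O} := u *: 'X^d + b%:P.

Section InExtension.
Variable L : fieldExtType K.
Local Notation emb := (@oalg K L).
Local Notation phi := (fun x : L => emb u * x ^+ d + emb b).

Lemma horner_map_f (x : L) : (map_poly emb f).[x] = phi x.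
Proof. by rewrite rmorphD /= map_polyZ map_polyXn map_polyC !hornerE. Qed.

Lemma horner_map_iter n (x : L) : (map_poly emb (poly_iter f n)).[x] = iter n phi x.
Proof.
rewrite horner_poly_iter; elim: n => //= n ->; exact: horner_map_f.
Qed.

Lemma root_map_iter n (al : L) :
  root (map_poly emb (poly_iter f n - a%:P)) al = (iter n phi al == emb a).
Proof.
by rewrite rootE rmorphB /= map_polyC hornerD hornerN hornerC horner_map_iter subr_eq0.
Qed.

Lemma emb_orbit n : emb ((poly_iter f n).[0]) = iter n phi 0.
Proof. by rewrite -horner_map raddf0 horner_map_iter. Qed.

Let vu : emb u^-1 * emb u = 1.
Proof. by rewrite -rmorphM mulVr // rmorph1. Qed.

(** The shift [g = al ^+ m - c] generates a subextension of degree exactly [p ^ k]: at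
    most, since [g] is a root of a shifted binomial; at least, since its first powers
    are independent over [R], of which the base field is the fraction field. *)
Lemma dim_chain_step (al c : L) p k m (R : subringClosed L) :
  prime p -> c \in R ->
  {subset R <= <<1; phi al>>%VS} ->
  (forall x, x \in <<1; phi al>>%VS -> exists2 N, (0 < N)%N & N%:R * x \in R) ->
  (al ^+ m) ^+ (p ^ k) \in <<1; phi al>>%VS ->
  (forall r : nat -> L, (forall i, r i \in R) ->
    \sum_(i < p ^ k) r i * (al ^+ m - c) ^+ i = 0 ->
    forall i, (i < p ^ k)%N -> r i = 0) ->
  (p ^ k %| adjoin_degree <<1; phi al>> al)%N.
Proof.
move=> p_pr cR RF clear_den alF ind; set F := <<1; phi al>>%AS; set g := al ^+ m - c.
have cF : c \in F by apply: RF.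
set n := (p ^ k)%N in ind alF *.
have n_gt0 : (0 < n)%N by rewrite expn_gt0 prime_gt0.
have gE : g \in <<F; al>>%VS.
  by rewrite rpredB ?rpredX ?memv_adjoin // subvP_adjoin.
have le1 : (adjoin_degree F g <= n)%N.
  (* The binomial satisfied by [al ^+ m], shifted by [c]. *)
  pose q : {poly L} := ('X + c%:P) ^+ n - ((al ^+ m) ^+ n)%:P.
  have qF : q \is a polyOver F.
    by rewrite rpredB ?rpredX ?rpredD ?polyOverX ?polyOverC.
  have qg : root q g.
    by rewrite rootE !(hornerD, hornerN, horner_exp, hornerC, hornerX) subrK subrr.
  have szq : size q = n.+1.
    have s1 : size (('X + c%:P) ^+ n) = n.+1.
      by rewrite -[c%:P]opprK -polyCN size_exp_XsubC.
    by rewrite size_polyDl ?s1 // size_polyN (leq_ltn_trans (size_polyC_leq1 _)).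
  have /dvdp_leq : minPoly F g %| q by apply: minPoly_dvdp.
  by rewrite -size_poly_gt0 szq size_minPoly; apply.
have ge1 : (n <= adjoin_degree F g)%N.
  rewrite leqNgt; apply/negP => ltn_e.
  set e := adjoin_degree F g in ltn_e.
  pose q := minPoly F g.
  have /polyOverP qF : q \is a polyOver F by apply: minPolyOver.
  have [i _|N N_gt0 hN] := @common_denominator_seq _ R n (fun i => q`_i); first exact: clear_den.
  have szq : size q = e.+1 by rewrite size_minPoly.
  pose r i := if (i < n)%N then N%:R * q`_i else 0.
  have rR i : r i \in R by rewrite /r; case: ifP => [/hN //|]; rewrite rpred0.
  have re : r e = 0.
    apply: ind => //; transitivity (N%:R * q.[g]); last first.
      by have := root_minPoly F g; rewrite rootE => /eqP->; rewrite mulr0.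
    rewrite (@horner_coef_wide _ n) ?szq // mulr_sumr; apply: eq_bigr => i _.
    by rewrite /r ltn_ord mulrA.
  have qe : q`_e = 1.
    by have /monicP := monic_minPoly F g; rewrite lead_coefE -/q szq.
  move/eqP: re; rewrite /r ltn_e qe mulr1 (number_field_ext L).1 => /eqP N0.
  by rewrite N0 in N_gt0.
have dimg : \dim <<F; g>> = (n * \dim F)%N.
  by rewrite (dim_Fadjoin F g); congr (_ * _)%N; apply/eqP; rewrite eqn_leq le1.
have : (\dim <<F; g>>%AS %| \dim <<F; al>>%AS)%N.
  by apply: field_dimS; apply/FadjoinP; split; rewrite ?subv_adjoin.
by rewrite /= dimg (dim_Fadjoin F al) dvdn_pmul2r // adim_gt0.
Qed.

Section TowerReady.
Hypothesis ready0 : tower_ready d (emb u) (emb u^-1) (emb b) (@Oimage K L) (emb a).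

Lemma tower_ready_adjoin n al : iter n phi al = emb a ->
  {subset adjoin_pred (@Oimage K L) al <= @algint L} /\
  tower_ready d (emb u) (emb u^-1) (emb b) (adjoin_pred (@Oimage K L) al) al.
Proof.
by apply: (tower_ready_iterates (number_field_ext L) (@Oimage_algint _ L) d_gt1 _ _ _ vu _ ready0);
  rewrite mem_Oimage.
Qed.

Lemma adjoin_sub_Fadjoin (al : L) : {subset adjoin_pred (@Oimage K L) al <= <<1; al>>%VS}.
Proof.
move=> _ /adjoin_OimageP[q ->]; apply/Fadjoin1_polyP; exists (map_poly val q).
by rewrite -map_poly_comp.
Qed.

Lemma Fadjoin_clear_denominator (al x : L) : x \in <<1; al>>%VS ->
  exists2 N, (0 < N)%N & N%:R * x \in adjoin_pred (@Oimage K L) al.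
Proof.
move=> /Fadjoin1_polyP[q ->].
have [i _|N N_gt0 hN] := @common_denominator_seq _ (@algint K) (size q) (fun i => q`_i).
  exact: algint_clear_denominator (number_field_rat K) _.
exists N => //; rewrite horner_coef size_map_poly mulr_sumr rpred_sum // => i _.
rewrite mulrA rpredM ?rpredX ?mem_adjoin //; apply: sub_adjoin.
rewrite coef_map -(rmorph_nat (in_alg L)) -rmorphM /=; apply: scalar_Oimage.
by rewrite algint_scalar hN.
Qed.

(** Each storey is generated by a root of [x ^+ d - t], so its degree is at most [d];
    it is divisible by every prime power exactly dividing [d]. *)
Lemma dim_Fadjoin_iter n al : iter n phi al = emb a -> \dim <<1; al>> = (d ^ n)%N.
Proof.
elim: n al => [|n IH] al.
  move=> /= ->; have aF : emb a \in 1%VS by rewrite memvZ ?mem1v.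
  by rewrite (Fadjoin_idP aF) dimv1.
rewrite iterSr => paE; have dimF := IH _ paE.
have [Rint gR] := tower_ready_adjoin paE; set R := adjoin_pred _ _ in Rint gR.
set F := <<1; phi al>>%AS; rewrite -/F in dimF.
have embF x : emb x \in F.
  by apply/subvP_adjoin; rewrite memvZ ?mem1v.
have phiF : phi al \in F by apply: memv_adjoin.
have tE : al ^+ d = emb u^-1 * (phi al - emb b) by rewrite addrK mulrA vu mul1r.
have tF : al ^+ d \in F by rewrite tE; apply: rpredM (embF _) _; apply: rpredB (embF _).
have FalE : <<1; al>>%VS = <<F; al>>%VS.
  apply/eqP; rewrite eqEsubv; apply/andP; split.
    by rewrite sub_adjoin1v memv_adjoin.
  apply/FadjoinP; split; last exact: memv_adjoin.
  rewrite sub_adjoin1v rpredD ?rpredM ?rpredX ?memv_adjoin //.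
    by apply/subvP_adjoin; rewrite memvZ ?mem1v.
  by apply/subvP_adjoin; rewrite memvZ ?mem1v.
rewrite FalE (dim_Fadjoin F al) expnS; congr (_ * _)%N => //.
have d_gt0 : (0 < d)%N by apply: ltnW.
apply/eqP; rewrite eqn_leq; apply/andP; split.
  have qF : ('X^d - (al ^+ d)%:P) \is a polyOver F.
    by rewrite rpredB ?rpredX ?polyOverX ?polyOverC.
  have qal : root ('X^d - (al ^+ d)%:P) al.
    by rewrite rootE !(hornerD, hornerN, hornerXn, hornerC) subrr.
  have := dvdp_leq _ (minPoly_dvdp qF qal).
  by rewrite -size_poly_gt0 size_XnsubC // size_minPoly; apply.
have e_gt0 : (0 < adjoin_degree F al)%N by [].
(* Lower bound, one prime at a time. *)
apply: dvdn_leq => //; apply/dvdn_partP => // p.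
rewrite mem_primes => /and3P[p_pr _ pd]; rewrite p_part.
have k_gt0 : (0 < logn p d)%N by rewrite logn_gt0 mem_primes p_pr d_gt0.
have [m _ dE] := pfactor_coprime p_pr d_gt0; rewrite mulnC in dE.
have aSal : al \in adjoin_pred (@Oimage K L) al by apply: mem_adjoin.
have pRal : phi al \in adjoin_pred (@Oimage K L) al.
  have eS x : emb x \in adjoin_pred (@Oimage K L) al by apply/sub_adjoin/mem_Oimage.
  by apply: rpredD (eS b); apply: rpredM (eS u) _; apply: rpredX.
have [Sint _] := @tower_ready_adjoin n.+1 al (etrans (iterSr _ _ _) paE).
have [c cR ind] := tower_ready_independent (number_field_ext L)
  (@mem_Oimage K L u^-1) (@mem_Oimage K L b) vu (@sub_adjoin _ _ _)
  (adjoin_sub (@sub_adjoin _ _ _) pRal) Sint aSal (@mem_adjoin _ _ _) gR p_pr dE k_gt0.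
apply: (dim_chain_step p_pr cR) ind.
- exact: adjoin_sub_Fadjoin.
- exact: Fadjoin_clear_denominator.
by rewrite -exprM mulnC -dE.
Qed.

Lemma adjoin_eq_integers n al : iter n phi al = emb a ->
  [set (map_poly emb q).[al] | q in [set: {poly O}]]
    = [set x : L | x \in <<1; al>>%VS /\ x \in @algint L].
Proof.
move=> alE; have [Rint gR] := tower_ready_adjoin alE.
apply/seteqP; split=> x /=.
  move=> [q _ <-]; have xR : (map_poly emb q).[al] \in adjoin_pred (@Oimage K L) al.
    by apply/adjoin_OimageP; exists q.
  by split; [apply: adjoin_sub_Fadjoin | apply: Rint].
case=> xF xint; have [N N_gt0 NxR] := Fadjoin_clear_denominator xF.
have := integrally_closed_of_locally_principal (number_field_ext L) Rint
  (ready_locally_principal gR) xint N_gt0 NxR.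
by move=> /adjoin_OimageP[q ->]; exists q.
Qed.

End TowerReady.

End InExtension.

End Sufficiency.

(** * The two implications *)

Lemma irreducible_factor (F : fieldType) (g : {poly F}) : (1 < size g)%N ->
  exists2 q, irreducible_poly q & q %| g.
Proof.
move=> sz_g; have g0 : g != 0 by rewrite -size_poly_gt0 ltnW.
pose Q m := `[< exists q : {poly F}, [/\ (1 < size q)%N, size q = m & q %| g] >].
have exQ : exists m, Q m by exists (size g); apply/asboolP; exists g.
case: (ex_minnP exQ) => m /asboolP[q [sz_q qm qg]] minm.
exists q => //; split=> // r r1 rq.
have q0 : q != 0 by rewrite -size_poly_gt0 ltnW.
have r0 : r != 0 by apply: contraNneq q0 => r0; move: rq; rewrite r0 dvd0p.
rewrite -dvdp_size_eqp // eqn_leq dvdp_leq // qm; apply: minm; apply/asboolP.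
exists r; split=> //; last exact: dvdp_trans qg.
by rewrite ltn_neqAle eq_sym r1 size_poly_gt0.
Qed.

Lemma size_cofactor (R : idomainType) (q r g : {poly R}) n :
  q \is monic -> r != 0 -> (1 < size q)%N -> size g = n -> q * r = g -> (size r < n)%N.
Proof.
move=> qmon r0 szq <- <-; rewrite size_monicM // -subn1 ltn_subRL.
by rewrite ltn_add2r.
Qed.

Section Polynomials.
Variables (K : fieldExtType rat) (d : nat) (d_gt1 : (1 < d)%N).
Variables (a u b : ring_of_integers K) (hu : u \is a GRing.unit).
Local Notation O := (ring_of_integers K).
Local Notation f := (u *: 'X^d + b%:P : {poly O}).

Let d_gt0 : (0 < d)%N. Proof. exact: ltnW. Qed.

Let u0 : u != 0. Proof. by apply: contraTneq hu => ->; rewrite unitr0. Qed.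

Lemma size_f : size f = d.+1.
Proof.
by rewrite size_polyDl size_scale // size_polyXn // (leq_ltn_trans (size_polyC_leq1 _)).
Qed.

Lemma lead_coef_f : lead_coef f = u.
Proof.
rewrite lead_coefDl ?lead_coefZ ?lead_coefXn ?mulr1 //.
by rewrite size_scale // size_polyXn (leq_ltn_trans (size_polyC_leq1 _)).
Qed.

Lemma size_iter_f n : size (poly_iter f n) = (d ^ n).+1 /\
  lead_coef (poly_iter f n) \is a GRing.unit.
Proof.
elim: n => [|n [szn ln]]; first by rewrite size_polyX lead_coefX unitr1.
have sz1 : (1 < size (poly_iter f n))%N by rewrite szn ltnS expn_gt0 d_gt0.
rewrite poly_iterS lead_coef_comp // lead_coef_f unitrM hu unitrX //; split=> //.
have f0 : f != 0 by rewrite -size_poly_gt0 size_f.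
have : (0 < size (f \Po poly_iter f n))%N by rewrite size_poly_gt0 comp_poly_eq0.
by move/prednK => <-; rewrite size_comp_poly size_f szn /= expnS.
Qed.

Lemma size_iter_sub n : size (poly_iter f n - a%:P) = (d ^ n).+1 /\
  lead_coef (poly_iter f n - a%:P) \is a GRing.unit.
Proof.
have [szn ln] := size_iter_f n.
have lt : (size (- a%:P) < size (poly_iter f n))%N.
  by rewrite size_polyN szn (leq_ltn_trans (size_polyC_leq1 _)) // ltnS expn_gt0 d_gt0.
by rewrite size_polyDl // lead_coefDl.
Qed.

Lemma size_map_val (g : {poly O}) : size (map_poly val g : {poly K}) = size g.
Proof. by apply: size_map_inj_poly; [exact: val_inj | exact: rmorph0]. Qed.

Lemma map_alg_val (L : fieldExtType K) (g : {poly O}) :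
  map_poly (in_alg L) (map_poly val g : {poly K}) = map_poly (@oalg K L) g.
Proof. by rewrite -map_poly_comp. Qed.

Section Sufficiency.
Hypothesis orbit_bound : forall n : nat, (0 < n)%N ->
  forall P : prime_idealr O, nonzero_ideal P -> d%:R \notin P ->
  (adic_val P ((poly_iter f n).[0] - a) <= 1%:E)%E.
Hypothesis not_pth_power : forall P : prime_idealr O, nonzero_ideal P ->
  forall p : nat, residue_char P p -> (p %| d)%N ->
  forall c : O, ~ ideal_exp [set` P] 2 ((a - b) / u - c ^+ p).

Lemma tower_ready_base (L : fieldExtType K) :
  tower_ready d (@oalg K L u) (oalg L u^-1) (oalg L b) (@Oimage K L) (oalg L a).
Proof.
split=> [P|P hP nPd j|P hP p p_pr Pp pd c /OimageP[c' ->]].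
- exact: Oimage_locally_principal.
- have [I IE] := prime_preimage hP.
  have ndI : d%:R \notin I by apply/negP => /IE; rewrite rmorph_nat.
  have /adic_val_le1 nI := orbit_bound (ltn0Sn j) (preimage_nonzero hP IE) ndI.
  by rewrite -emb_orbit -rmorphB => /(sq_preimage hP IE).
have [I IE] := prime_preimage hP.
have Ip : residue_char I p by apply/residue_charP; split=> //; apply/IE; rewrite rmorph_nat.
have := not_pth_power (preimage_nonzero hP IE) Ip pd (c := c').
rewrite -rmorphB -rmorphXn -rmorphM -rmorphB mulrC => nI sqI; apply: nI.
exact: (sq_preimage hP IE).
Qed.

(** A root of an irreducible factor already generates an extension of degree
    [d ^ n]. *)
Lemma irreducible_of_conditions n : irreducible_over (poly_iter f n - a%:P).
Proof.
have [szg lg] := size_iter_sub n; set g := poly_iter f n - a%:P in szg lg *.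
rewrite /irreducible_over; set gK := map_poly _ g.
have szK : size gK = (d ^ n).+1 by rewrite size_map_val.
have sz1 : (1 < size gK)%N by rewrite szK ltnS expn_gt0 d_gt0.
have g0 : gK != 0 by rewrite -size_poly_gt0 ltnW.
split=> // q q1 qg.
have q0 : q != 0 by apply: contraNneq g0 => q0; move: qg; rewrite q0 dvd0p.
have szq : (1 < size q)%N by rewrite ltn_neqAle eq_sym q1 size_poly_gt0.
have [r irr_r rq] := irreducible_factor szq.
have [L dimL [z rz zL]] := irredp_FAdjoin irr_r.
have rtz : root (map_poly (@oalg K L) g) z.
  rewrite -map_alg_val; apply: root_dvdp rz.
  by rewrite dvdp_map (dvdp_trans rq).
move: rtz; rewrite root_map_iter => /eqP zE.
have := dim_Fadjoin_iter d_gt1 hu (tower_ready_base L) zE.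
rewrite zL dimL => szr.
rewrite -dvdp_size_eqp // eqn_leq dvdp_leq //= szK -szr prednK ?dvdp_leq //.
by rewrite size_poly_gt0 irredp_neq0.
Qed.

Lemma monogenic_of_conditions : dynamically_monogenic f a.
Proof.
move=> n _; split; first by have [] := size_iter_sub n.
  exact: irreducible_of_conditions.
move=> L al; rewrite root_map_iter => /eqP alE.
exact: (adjoin_eq_integers d_gt1 hu (tower_ready_base L) alE).
Qed.

End Sufficiency.

Section Necessity.
Variables (I : prime_idealr O) (hI : nonzero_ideal I).

Let PK : set K := [set x | exists2 c, c \in I & x = val c].

Let PK_prime : nonzero_prime (@algint K) PK.
Proof.
split.
- by move=> _ [c _ ->]; apply: ovalP.
- by move=> _ _ [c cI ->] [e eI ->]; exists (c + e); rewrite ?rpredD ?rmorphD.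
- move=> r _ rO [c cI ->]; exists (RingOfIntegers rO * c); first exact: idealMr.
  by rewrite rmorphM.
- case=> c cI /esym c1; have : c = 1 by apply: val_inj; rewrite rmorph1.
  by move=> c1'; move: cI; rewrite c1' idealr1.
- move=> x y xO yO [c cI cE].
  have : RingOfIntegers xO * RingOfIntegers yO \in I.
    by have -> : RingOfIntegers xO * RingOfIntegers yO = c by apply: val_inj; rewrite rmorphM.
  rewrite prime_idealrM => /orP[xI|yI].
    by left; exists (RingOfIntegers xO).
  by right; exists (RingOfIntegers yO).
- have [c cI c0] := hI; exists (val c); first by exists c.
  by apply: contraNneq c0 => c0; apply/eqP/val_inj; rewrite c0 rmorph0.
Qed.

Lemma inverse_ideal : exists lam : K, [/\ lam \notin @algint K,
  forall c, c \in I -> val c * lam \in @algint K &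
  forall c, ideal_exp [set` I] 2 c -> val c * lam ^+ 2 \in @algint K].
Proof.
have [|lam [lamO _ hlam]] := @inverse_prime K (number_field_rat K) (@algint K) _ PK PK_prime.
  by [].
have h1 c : c \in I -> val c * lam \in @algint K by move=> cI; apply: hlam; exists c.
exists lam; split=> // c /ideal_exp2_in[s hs ->].
rewrite rmorph_sum mulr_suml big_seq rpred_sum //= => z /hs[z1 z2].
have -> : val (z.1 * z.2) * lam ^+ 2 = (val z.1 * lam) * (val z.2 * lam).
  by rewrite rmorphM; ring.
by rewrite rpredM ?h1.
Qed.

(** Reducing modulo [g], an element [lam * del(al)] of [O[al]] would be the value of an
    integral polynomial of degree less than that of [g]; comparing coefficients, [lam]
    times the leading coefficient of [del] would be integral. *)
Lemma not_monogenic (g del : {poly O}) (lam : K) :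
  lam \notin @algint K -> lead_coef del \is a GRing.unit -> (size del < size g)%N ->
  (forall (L : fieldExtType K) (al : L), root (map_poly (@oalg K L) g) al ->
    lam%:A * (map_poly (@oalg K L) del).[al] \in @algint L) ->
  ~ monogenic g.
Proof.
move=> lamO ldel szdel int [lg irr mono].
have [L dimL [al]] := irredp_FAdjoin irr.
rewrite map_alg_val => rt alL.
have : [set x : L | x \in <<1; al>>%VS /\ x \in @algint L]
  (lam%:A * (map_poly (@oalg K L) del).[al]).
  by split; [rewrite alL memvf | exact: int].
rewrite -mono // => -[q _ qE].
have g0 : g != 0 by rewrite -size_poly_gt0 (leq_trans _ szdel).
pose r := q %% g.
have szr : (size r < size g)%N by rewrite ltn_modp.
have rE : (map_poly (@oalg K L) r).[al] = lam%:A * (map_poly (@oalg K L) del).[al].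
  rewrite -qE {1}(Pdiv.IdomainUnit.divp_eq lg q) rmorphD rmorphM /= hornerD hornerM.
  by move/eqP: rt => ->; rewrite mulr0 add0r.
pose h : {poly K} := map_poly val r - lam *: map_poly val del.
have szh : (size h < size g)%N.
  rewrite (leq_ltn_trans (size_polyD _ _)) // gtn_max size_polyN size_map_val szr /=.
  by rewrite (leq_ltn_trans (size_scale_leq _ _)) // size_map_val.
have rth : root (map_poly (in_alg L) h) al.
  rewrite rootE /h rmorphB /= linearZ /= !map_alg_val hornerD hornerN hornerZ rE.
  by rewrite mulr_algl subrr.
have h0 : h = 0.
  apply/eqP; apply: contraTT szh => h0; rewrite -leqNgt.
  have hO : map_poly (in_alg L) h \is a polyOver 1%VS.
    by apply/polyOverP => i; rewrite coef_map /= memvZ ?mem1v.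
  have := dvdp_leq _ (minPoly_dvdp hO rth).
  rewrite map_poly_eq0 => /(_ h0); rewrite size_map_poly size_minPoly.
  have := dim_Fadjoin 1%AS al; rewrite alL dimL dimv1 muln1 => <-.
  by rewrite size_map_val prednK // size_poly_gt0.
have : val r`_(size del).-1 = lam * val (lead_coef del) :> K.
  have := congr1 (fun p : {poly K} => p`_(size del).-1) h0.
  rewrite coefB coefZ !coef_map coef0 => /eqP; rewrite subr_eq0 => /eqP ->.
  by rewrite lead_coefE.
move=> lamE; case/negP: lamO.
have -> : lam = val (r`_(size del).-1 * (lead_coef del)^-1).
  rewrite rmorphM /= lamE -mulrA.
  have -> : val (lead_coef del) * val (lead_coef del)^-1 = 1.
    by rewrite -rmorphM divrr // rmorph1.
  by rewrite mulr1.
exact: ovalP.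
Qed.

Lemma scalar_mul_sq (L : fieldExtType K) (x lam : K) :
  (x * lam ^+ 2)%:A = x%:A * lam%:A ^+ 2 :> L.
Proof. by rewrite -[LHS]/(in_alg L _) rmorphM rmorphXn. Qed.

Lemma root_algint (g : {poly O}) (L : fieldExtType K) (al : L) :
  lead_coef g \is a GRing.unit -> root (map_poly (@oalg K L) g) al -> al \in @algint L.
Proof.
move=> lg; have lE : lead_coef (map_poly (@oalg K L) g) = oalg L (lead_coef g).
  by rewrite lead_coef_map_inj //; [apply: oalg_inj | apply: raddf0].
have lVE : (lead_coef (map_poly (@oalg K L) g))^-1 = oalg L (lead_coef g)^-1.
  by rewrite lE rmorphV.
apply: algint_root_unit.
- by apply/polyOverP => i; rewrite coef_map Oimage_algint ?mem_Oimage.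
- by rewrite lVE Oimage_algint ?mem_Oimage.
rewrite -lead_coef_eq0 lE; apply: contraTneq lg => l0.
have -> : lead_coef g = 0 by apply: (@oalg_inj K L); rewrite l0 raddf0.
by rewrite unitr0.
Qed.

Lemma horner_algint (q : {poly O}) (L : fieldExtType K) (al : L) :
  al \in @algint L -> (map_poly (@oalg K L) q).[al] \in @algint L.
Proof.
move=> alO; apply: rpred_horner => //.
by apply/polyOverP => i; rewrite coef_map Oimage_algint ?mem_Oimage.
Qed.

(** Every iterate of [f] is a polynomial in [x ^+ d]; with [d > 1] its
    nonconstant part stays divisible by [x] after one division by [x]. *)
Lemma iter_f_lacunary n : exists c (h : {poly O}), poly_iter f n.+1 = c%:P + 'X^d * h.
Proof.
elim: n => [|n [c [h IH]]].
  by exists b, u%:P; rewrite /poly_iter /= comp_polyXr addrC mulrC mul_polyC.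
rewrite poly_iterS IH.
have -> : f \Po (c%:P + 'X^d * h) = u *: (c%:P + 'X^d * h) ^+ d + b%:P.
  by rewrite comp_polyD comp_polyZ comp_Xn_poly comp_polyC.
set y := 'X^d * h.
exists (u * c ^+ d + b), (u *: (h * \sum_(i < d) (c%:P + y) ^+ (d.-1 - i) * c%:P ^+ i)).
rewrite -scalerAr mulrA -/y.
have -> : y * \sum_(i < d) (c%:P + y) ^+ (d.-1 - i) * c%:P ^+ i = (c%:P + y) ^+ d - c%:P ^+ d.
  by rewrite subrXX; congr (_ * _); ring.
by rewrite polyCD polyCM polyC_exp -!mul_polyC; ring.
Qed.

(** Here [G = x]: with [c0] the constant term, [al * D = - c0] and [D] is divisible by
    [al], so [(lam D)^2 = - lam^2 c0 al^e H(al)]. *)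
Lemma orbit_condition n : (0 < n)%N -> monogenic (poly_iter f n - a%:P) ->
  ~ ideal_exp [set` I] 2 ((poly_iter f n).[0] - a).
Proof.
case: n => // n _ mono Ic0; have [lam [lamO hlam1 hlam2]] := inverse_ideal.
have [szg lg] := size_iter_sub n.+1.
have [c [h hE]] := iter_f_lacunary n.
set g := poly_iter f n.+1 - a%:P in mono szg lg.
have c0E : (poly_iter f n.+1).[0] = c.
  by rewrite hE hornerD hornerM hornerC hornerXn expr0n gtn_eqF // mul0r addr0.
rewrite c0E in Ic0.
pose del : {poly O} := 'X^(d.-1) * h.
have gE : g = 'X * del + (c - a)%:P.
  by rewrite /g hE /del mulrA -exprS prednK // polyCB; ring.
have szg1 : (1 < size g)%N by rewrite szg ltnS expn_gt0 d_gt0.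
have lt : (size (- (c - a)%:P) < size g)%N.
  by rewrite size_polyN (leq_ltn_trans (size_polyC_leq1 _)).
have XdE : 'X * del = g - (c - a)%:P by rewrite gE addrK.
have szX : size ('X * del) = size g by rewrite XdE; exact: size_polyDl lt.
have del0 : del != 0.
  by apply: contraTneq szg1 => del0; rewrite -szX del0 mulr0 size_poly0.
apply: (@not_monogenic g del lam lamO _ _ _ mono).
- by rewrite -(lead_coefMX del) mulrC XdE lead_coefDl.
- by rewrite -szX mulrC size_mulX.
move=> L al rt; have alO := root_algint lg rt.
set D := (map_poly _ del).[al]; set H := (map_poly (@oalg K L) h).[al].
have DE : D = al ^+ d.-1 * H by rewrite /D rmorphM /= map_polyXn hornerM hornerXn.
have alD : al * D = - oalg L (c - a).
  apply/eqP; rewrite -addr_eq0; move: rt.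
  by rewrite rootE gE rmorphD rmorphM /= map_polyX map_polyC !hornerE.
have [e dE] : exists e, d = e.+2 by exists d.-2; case: (d) d_gt1 => [|[]].
have DE' : D = al * (al ^+ e * H) by rewrite DE dE exprS mulrA.
apply: (@algint_quadratic _ (- (val (c - a) * lam ^+ 2)%:A * (al ^+ e * H)) 0).
- rewrite rpredM ?rpredN ?algint_scalar ?hlam2 // rpredM ?rpredX //.
  exact: horner_algint.
- exact: rpred0.
rewrite mul0r addr0.
have -> : (lam%:A * D) ^+ 2 = lam%:A ^+ 2 * (al * D) * (al ^+ e * H).
  by rewrite exprMn [D ^+ 2]expr2 {1}DE'; ring.
rewrite alD scalar_mul_sq -/(oalg L (c - a)).
by move: (oalg L _) (lam%:A) (al ^+ e * H) => x y z; ring.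
Qed.

(** Here [G = x ^+ m - c] and [d = m p].  With [gam = al ^+ m - c], the cofactor [D] of
    [gam] in [al ^+ d - c ^+ p] is [gam ^+ p.-1 + p w], whence
    [(lam D)^2 = lam^2 (gam D) gam ^+ e + (lam p w) (lam D)] with [p = e + 2]. *)
Lemma wild_condition p c : monogenic (poly_iter f 1 - a%:P) ->
  prime p -> p%:R \in I -> (p %| d)%N ->
  ~ ideal_exp [set` I] 2 ((a - b) / u - c ^+ p).
Proof.
move=> mono p_pr pI /dvdnP[m dE] Ie; have [lam [lamO hlam1 hlam2]] := inverse_ideal.
have [szg lg] := size_iter_sub 1; set g := poly_iter f 1 - a%:P in mono szg lg.
rewrite expn1 in szg.
have m_gt0 : (0 < m)%N by move: d_gt0; rewrite dE muln_gt0 => /andP[].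
pose q : {poly O} := 'X^m - c%:P.
have szq : size q = m.+1 by rewrite size_XnsubC.
have qmon : q \is monic by apply: monicXnsubC.
pose del := \sum_(i < p) ('X^m) ^+ (p.-1 - i) * (c%:P : {poly O}) ^+ i.
have qdel : q * del = 'X^d - (c ^+ p)%:P.
  by rewrite -subrXX -exprM -dE polyC_exp.
have delmon : del \is monic.
  by rewrite -(monicMl _ qmon) qdel monicXnsubC.
apply: (@not_monogenic g del lam lamO _ _ _ mono).
- by rewrite (monicP delmon) unitr1.
- rewrite szg; apply: (size_cofactor qmon (monic_neq0 delmon) _ _ qdel).
    by rewrite szq ltnS.
  exact: size_XnsubC.
move=> L al rt; have alO := root_algint lg rt.
set gam := al ^+ m - oalg L c; set D := (map_poly (oalg L) del).[al].
have embO x : oalg L x \in @algint L by rewrite Oimage_algint ?mem_Oimage.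
have gamO : gam \in @algint L by apply: rpredB (embO c); apply: rpredX.
have alX : al ^+ d = oalg L ((a - b) / u).
  move: rt; rewrite root_map_iter /= => /eqP E.
  have -> : oalg L ((a - b) / u) = (oalg L a - oalg L b) * oalg L u^-1.
    by rewrite rmorphM rmorphB.
  by rewrite -E addrK mulrAC -rmorphM divrr // rmorph1 mul1r.
have gamD : gam * D = oalg L ((a - b) / u - c ^+ p).
  have := congr1 (fun r => (map_poly (oalg L) r).[al]) qdel.
  rewrite rmorphM hornerM !rmorphB /= !map_polyXn !map_polyC !hornerE => ->.
  by rewrite alX.
have [w wO frob] := frobenius1 p_pr gamO (embO c).
have plam : p%:R * lam%:A \in @algint L.
  rewrite -[p%:R](rmorph_nat (in_alg L)) -rmorphM /= algint_scalar.
  by have := hlam1 _ pI; rewrite rmorph_nat.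
have DE : D = \sum_(i < p) (al ^+ m) ^+ (p.-1 - i) * oalg L c ^+ i.
  rewrite /D rmorph_sum horner_sum; apply: eq_bigr => i _.
  by rewrite rmorphM !rmorphXn /= map_polyX map_polyC hornerM !horner_exp hornerX hornerC.
(* When [gam] vanishes, [D] is the multiple [p * c ^+ p.-1] of [p]. *)
have [gam0|gam0] := eqVneq gam 0.
  have almE : al ^+ m = oalg L c by apply/eqP; rewrite -subr_eq0 -/gam gam0.
  have -> : lam%:A * D = p%:R * lam%:A * oalg L c ^+ p.-1.
    rewrite DE (eq_bigr (fun=> oalg L c ^+ p.-1)); last first.
      by move=> i _; rewrite almE -exprD subnK // -ltnS prednK ?prime_gt0.
    by rewrite sumr_const card_ord -mulr_natl; ring.
  exact: rpredM plam (rpredX _ (embO c)).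
have [e pE] : exists e, p = e.+2 by case: (p) (prime_gt1 p_pr) => [|[|e]] // _; exists e.
have DE2 : D = gam ^+ p.-1 + p%:R * w.
  apply: (mulfI gam0); rewrite gamD rmorphB rmorphXn /= -alX dE exprM.
  rewrite -[al ^+ m](subrK (oalg L c)) -/gam frob mulrDr -exprS prednK ?prime_gt0 //.
  ring.
apply: (@algint_quadratic _ ((val ((a - b) / u - c ^+ p) * lam ^+ 2)%:A * gam ^+ e)
   (p%:R * lam%:A * w)).
- by rewrite rpredM ?rpredX // algint_scalar hlam2.
- exact: rpredM.
have -> : (lam%:A * D) ^+ 2 = lam%:A ^+ 2 * (gam * D) * gam ^+ e +
   p%:R * lam%:A * w * (lam%:A * D).
  by rewrite expr2 {2}DE2 pE /= exprS; ring.
congr (_ + _); rewrite gamD scalar_mul_sq -/(oalg L _).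
by rewrite [lam%:A ^+ 2 * _]mulrC.
Qed.

End Necessity.

End Polynomials.

Theorem theorem4p1 (K : fieldExtType rat) (d : nat) (hd : (2 <= d)%N)
  (a u b : ring_of_integers K) (hu : u \is a GRing.unit) :
  let f : {poly ring_of_integers K} := u *: 'X^d + b%:P in
  (dynamically_monogenic f a <->
     (forall n : nat, (0 < n)%N ->
        forall P : prime_idealr (ring_of_integers K), nonzero_ideal P -> d%:R \notin P ->
        (adic_val P ((poly_iter f n).[0] - a) <= 1%:E)%E)
     /\
     (forall P : prime_idealr (ring_of_integers K), nonzero_ideal P ->
        forall p : nat, residue_char P p -> (p %| d)%N ->
        forall c : ring_of_integers K, ~ ideal_exp [set` P] 2 ((a - b) / u - c ^+ p)))
  /\ (dynamically_monogenic f a -> dynamically_irreducible f a).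
Proof.
move=> f; split; last by move=> mono n n_gt0; have [] := mono n n_gt0.
split=> [mono|[orbit_bound not_pth_power]]; last exact: monogenic_of_conditions.
split=> [n n_gt0 P hP _|P hP p /residue_charP[p_pr pP] pd c].
  by apply/adic_val_le1; apply: orbit_condition => //; apply: mono.
by apply: (wild_condition hd hu hP) => //; apply: mono.
Qed.
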